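(* Let $f:\mathbb{R}^n\to\mathbb{R}$ be nonconvex, twice differentiable and bounded below, with $f^*:=\inf_x f(x)>-\infty$, and suppose that $\|\nabla^2 f(x)-\nabla^2 f(y)\|\le M\|x-y\|$ for all $x,y\in\mathbb{R}^n$, where $M>0$. Then the adaptive universal trust-region method, started at $x_0\in\mathbb{R}^n$ with tolerance $\epsilon>0$, takes $$O\left(\rho_{\max}\,(f(x_0)-f^* )\,\epsilon^{-3/2}\,\log\left(G_a/\epsilon\right)\,\log_{\gamma_1}\left(\rho_{\max}/\rho_{\min}\right)\right)$$ iterations to find an $\epsilon$-approximate second-order stationary point, i.e. a point $x$ satisfying $$\|\nabla f(x)\|\le O(\epsilon)\quad\text{and}\quad\lambda_{\min}(\nabla^2 f(x))\ge\Omega(-\sqrt\epsilon).$$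
   Context: Norms are the Euclidean norm for vectors and the induced operator norm for matrices; $\lambda_{\min}$ is the smallest eigenvalue. Subproblem. Given $x_k$, $\sigma\ge0$ and $r>0$: minimize $\tfrac12 d^T(\nabla^2 f(x_k)+\sigma\|\nabla f(x_k)\|^{1/2}I)d+\nabla f(x_k)^Td$ subject to $\|d\|\le r\|\nabla f(x_k)\|^{1/2}$. A solution $d$ comes with a multiplier $\lambda\ge0$ such that $\lambda(\|d\|-r\|\nabla f(x_k)\|^{1/2})=0$, $(\nabla^2 f(x_k)+\sigma\|\nabla f(x_k)\|^{1/2}I+\lambda I)d=-\nabla f(x_k)$, and $\nabla^2 f(x_k)+\sigma\|\nabla f(x_k)\|^{1/2}I+\lambda I\succeq0$. Adaptive universal trust-region method. Parameters: $x_0$, tolerance $\epsilon>0$, $0<\eta<\frac1{32}$, $\frac14<\xi<1$, initial penalty $\rho_0>0$, minimal penalty $\rho_{\min}>0$, $\gamma_1>1$, $\gamma_2>1$. For $k=0,1,\dots$ (outer loop): set $\rho_k^{(0)}=\rho_k$; for $j=0,1,\dots$ (inner loop): choose $(\sigma_k^{(j)},r_k^{(j)})$ by the strategy below, solve the subproblem with $\sigma=\sigma_k^{(j)}$, $r=r_k^{(j)}$ to get $(d_k^{(j)},\lambda_k^{(j)})$, and leave the inner loop if the acceptance test below holds; otherwise set $\rho_k^{(j+1)}=\gamma_1\rho_k^{(j)}$. On leaving the inner loop set $x_{k+1}=x_k+d_k^{(j)}$, $\rho_{k+1}=\max\{\rho_{\min},\rho_k^{(j)}/\gamma_2\}$.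 The factor $\log_{\gamma_1}(\rho_{\max}/\rho_{\min})$ in the bound accounts for the inner iterations. Strategy. Write $g=\|\nabla f(x_k)\|$, $\rho=\rho_k^{(j)}$, $\ell=\lambda_{\min}(\nabla^2 f(x_k))$. - If $g\ge\epsilon$ and ($\ell\le-\rho g^{1/2}$ or $\ell\ge\rho g^{1/2}$): $\sigma_k^{(j)}=0$, $r_k^{(j)}=1/(2\rho)$. - If $g\ge\epsilon$ and $-\rho g^{1/2}<\ell<\rho g^{1/2}$: $\sigma_k^{(j)}=\rho$, $r_k^{(j)}=1/(4\rho)$. - If $g<\epsilon$ and $\ell>-\rho\epsilon^{1/2}$: $x_k$ is already an $\epsilon$-approximate second-order stationary point and the method terminates. - If $g<\epsilon$ and $\ell\le-\rho\epsilon^{1/2}$: $\sigma_k^{(j)}=0$, $r_k^{(j)}=\epsilon^{1/2}/(2\rho g^{1/2})$, so that the trust-region radius is $\epsilon^{1/2}/(2\rho)$. Acceptance test for nonconvex $f$ (with $d=d_k^{(j)}$, $\lambda=\lambda_k^{(j)}$): $f(x_k+d)\le f(x_k)$; and, if $g\ge\epsilon$, [$f(x_k+d)-f(x_k)\le-\frac{\eta}{\rho}g^{3/2}$ or $\|\nabla f(x_k+d)\|\le\xi g$] together with $\|\nabla f(x_k+d)\|\le\xi g+\lambda\|d\|$; if $g<\epsilon$, $f(x_k+d)-f(x_k)\le-\frac\eta\rho\epsilon^{3/2}$ together with $\|\nabla f(x_k+d)\|\le\xi\epsilon+\lambda\|d\|$. Constants: $$\rho_{\max}:=\gamma_1\max\left\{\sqrt{\tfrac{M}{12(1-32\eta)}},\sqrt{\tfrac{M}{6(1-8\eta)}},\sqrt{\tfrac{M}{32\xi-8}},\sqrt{\tfrac{M}{8\xi}},\sqrt{\tfrac{M\xi}{8(1-\xi)}}\right\},$$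 $$G_a:=\max\left\{\left(\xi+\tfrac{M}{6\rho_{\min}^2}+16\eta\right)\left(\tfrac{\rho_{\max}(f(x_0)-f^* )}{\eta}\right)^{2/3},\ \|\nabla f(x_0)\|,\ \tfrac{32\rho_{\max}(f(x_0)-f^* )}{\sqrt\epsilon}\right\}.$$
   Formalization: Assumes ρ_min < ρ_max, and each of the three factors of the iteration bound (ρ_max(f(x_0)−f* )ε^{-3/2}, log(G_a/ε), log_{γ1}(ρ_max/ρ_min)) is replaced by its maximum with 1; otherwise the bound can be ≤ 0 or arbitrarily small although an iteration is needed. *)

(* Defs.v *)
From HB Require Import structures.
From mathcomp Require Import all_boot all_order all_algebra.
From mathcomp Require Import all_classical all_reals all_analysis.

Set Implicit Arguments.
Unset Strict Implicit.
Unset Printing Implicit Defensive.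

Import Order.TTheory GRing.Theory Num.Theory.
Import numFieldNormedType.Exports.

Local Open Scope classical_set_scope.
Local Open Scope ring_scope.

Section Euclidean.
Context {R : realType} {n : nat}.
Implicit Types (u v : 'rV[R]_n) (A : 'M[R]_n).

(* The library norm `|v| on 'rV[R]_n is the max norm, not the Euclidean one;
   both induce the same topology, hence the same notion of differentiability. *)
Definition l2norm v : R := Num.sqrt (\sum_i v ord0 i ^+ 2).

(* Vectors are rows and matrices act on the right. *)
Definition opnorm A : R :=
  sup [set l2norm (v *m A) | v in [set v | l2norm v <= 1]].

Definition inner u v : R := (u *m v^T) ord0 ord0.

Definition quad A v : R := inner (v *m A) v.

Definition psd A : Prop := forall v, 0 <= quad A v.

Definition lambda_min A : R := inf [set a : R | eigenvalue A a].

End Euclidean.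

Section Calculus.
Context {R : realType} {n : nat}.
Implicit Types (f : 'rV[R]_n -> R) (x : 'rV[R]_n).

Definition grad f x : 'rV[R]_n := \row_i 'D_(delta_mx ord0 i) f x.

Definition hess f x : 'M[R]_n := 'J (grad f) x.

Definition twice_differentiable f : Prop :=
  (forall x, differentiable f x) /\ (forall x, differentiable (grad f) x).

Definition lipschitz_hessian f (M : R) : Prop :=
  forall x y, opnorm (hess f x - hess f y) <= M * l2norm (x - y).

Definition nonconvex f : Prop :=
  ~ convex_function (setT : set (convex_lmodType 'rV[R]_n)) f.

Definition fstar f : R := inf (range f).

End Calculus.

Record params (R : realType) := Params {
  eta : R;
  xi : R;
  rho_init : R;
  rho_min : R;
  gamma1 : R;
  gamma2 : R
}.

Definition valid_params (R : realType) (p : params R) : Prop :=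
  [/\ 0 < eta p < 32^-1, 4^-1 < xi p < 1, 0 < rho_init p, 0 < rho_min p
    & 1 < gamma1 p /\ 1 < gamma2 p].

Section Algorithm.
Context {R : realType} {n : nat}.
Variables (p : params R) (f : 'rV[R]_n -> R) (eps : R).
Implicit Types (x d : 'rV[R]_n) (rho lam sigma radius : R).

Let gnorm x : R := l2norm (grad f x).

Definition reg_hess x sigma : 'M[R]_n :=
  hess f x + (sigma * Num.sqrt (gnorm x))%:M.

Definition model x sigma d : R :=
  2^-1 * quad (reg_hess x sigma) d + inner (grad f x) d.

Definition subproblem_solution x sigma radius d lam : Prop :=
  (l2norm d <= radius /\
   forall d', l2norm d' <= radius -> model x sigma d <= model x sigma d') /\
  [/\ 0 <= lam,
      lam * (l2norm d - radius) = 0,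
      d *m (reg_hess x sigma + lam%:M) = - grad f x
    & psd (reg_hess x sigma + lam%:M)].

Definition terminated x rho : bool :=
  (gnorm x < eps) && (- (rho * Num.sqrt eps) < lambda_min (hess f x)).

(* The pair (sigma, r * g^(1/2)).  The trust-region radius r * g^(1/2) is
   returned instead of r because r is infinite when g = 0 < eps.  The branch
   g < eps is only used when the method has not terminated. *)
Definition strategy x rho : R * R :=
  let g := gnorm x in
  let l := lambda_min (hess f x) in
  if eps <= g then
    if (l <= - (rho * Num.sqrt g)) || (rho * Num.sqrt g <= l)
    then (0, (2 * rho)^-1 * Num.sqrt g)
    else (rho, (4 * rho)^-1 * Num.sqrt g)
  else (0, Num.sqrt eps / (2 * rho)).

Definition accepted x rho d lam : bool :=
  let g := gnorm x in
  let df := f (x + d) - f x in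
  let g' := gnorm (x + d) in
  (f (x + d) <= f x) &&
  (if eps <= g then
     ((df <= - (eta p / rho * (g `^ (3 / 2)))) || (g' <= xi p * g)) &&
     (g' <= xi p * g + lam * l2norm d)
   else
     (df <= - (eta p / rho * (eps `^ (3 / 2)))) &&
     (g' <= xi p * eps + lam * l2norm d)).

(* A run, with the two nested loops flattened: the index t counts the
   subproblems solved, over both loops, and (x t, rho t) is the current
   (x_k, rho_k^(j)).  Acceptance starts the next outer iteration, rejection the
   next inner one.  The sequences are unconstrained after termination. *)
Definition run (x0 : 'rV[R]_n) (x : nat -> 'rV[R]_n) (rho : nat -> R)
    (d : nat -> 'rV[R]_n) (lam : nat -> R) : Prop :=
  [/\ x 0%N = x0, rho 0%N = rho_init p &
    forall t : nat, (forall s : nat, (s <= t)%N -> ~~ terminated (x s) (rho s)) ->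
      let: (sigma, radius) := strategy (x t) (rho t) in
      subproblem_solution (x t) sigma radius (d t) (lam t) /\
      if accepted (x t) (rho t) (d t) (lam t) then
        x t.+1 = x t + d t /\
        rho t.+1 = Num.max (rho_min p) (rho t / gamma2 p)
      else
        x t.+1 = x t /\ rho t.+1 = gamma1 p * rho t].

Definition terminates_after (x : nat -> 'rV[R]_n) (rho : nat -> R) (N : nat) :
    Prop :=
  terminated (x N) (rho N) /\
  forall t : nat, (t < N)%N -> ~~ terminated (x t) (rho t).

End Algorithm.

Section Constants.
Context {R : realType}.
Variables (p : params R) (M : R).

Definition rho_max : R :=
  gamma1 p *
  Num.max (Num.sqrt (M / (12 * (1 - 32 * eta p))))
 (Num.max (Num.sqrt (M / (6 * (1 - 8 * eta p))))
 (Num.max (Num.sqrt (M / (32 * xi p - 8)))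
 (Num.max (Num.sqrt (M / (8 * xi p)))
          (Num.sqrt (M * xi p / (8 * (1 - xi p))))))).

Context {n : nat}.
Variables (f : 'rV[R]_n -> R) (x0 : 'rV[R]_n) (eps : R).

Definition Ga : R :=
  Num.max ((xi p + M / (6 * rho_min p ^+ 2) + 16 * eta p) *
           ((rho_max * (f x0 - fstar f) / eta p) `^ (2 / 3)))
 (Num.max (l2norm (grad f x0))
          (32 * rho_max * (f x0 - fstar f) / Num.sqrt eps)).

(* The expression inside O(...).  Each of the three factors is read as at least
   1: without this the product may vanish or be negative (e.g. for Ga < eps)
   although some iterations are needed. *)
Definition iteration_bound : R :=
  Num.max 1 (rho_max * (f x0 - fstar f) * (eps `^ (- (3 / 2)))) *
  Num.max 1 (ln (Ga / eps)) *
  Num.max 1 (ln (rho_max / rho_min p) / ln (gamma1 p)).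

End Constants.

(* Main.v *)
Require Import Defs.
From HB Require Import structures.
From mathcomp Require Import all_boot all_order all_algebra.
From mathcomp Require Import all_classical all_reals all_analysis.
From mathcomp Require Import ring lra.

Import Order.TTheory GRing.Theory Num.Theory.
Import numFieldNormedType.Exports.

Local Open Scope classical_set_scope.
Local Open Scope ring_scope.

(** The proof weighs what one subproblem gains against what it may lose.

    A step with a Lipschitz Hessian obeys two Taylor bounds ([taylor_le] and
    [grad_taylor]). Let [G] be the maximum of the gradient norm and [eps]. Along
    the solution of a subproblem on the boundary of the trust region the model
    curves by at least [rho * G^(1/2)], whichever branch of the strategy is
    taken: through the multiplier when the Hessian is quite indefinite, through
    the Hessian when it is quite positive definite, through the regularization
    in between.
    In the positive definite case [lambda_min] has to bound the quadratic form
    from below ([quad_ge_lambda_min]), which rests on the symmetry of the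
    Hessian ([hess_sym]). If the penalty [rho] is at least
    [rho_max / gamma1], the Taylor errors are dominated and the step passes the
    acceptance test ([accepted_of_large]). Hence rejections cannot push the
    penalty above the larger of [rho_max] and the initial penalty.

    An accepted step either lowers [f] by at least a constant times
    [eps^(3/2)], or contracts a gradient norm of at least [eps] by [xi].
    The first kind happens at most [O(rho_max * (f x0 - fstar f) * eps^(-3/2))]
    times, because [f] is bounded below. Between two steps of the first kind
    there are at most logarithmically many contractions, provided that the
    gradient is bounded when such a series begins. A decrease step may enlarge
    the gradient, but only up to a multiple of [Ga] ([grad_after_decrease]):
    the new gradient norm is at most [xi * G + lam * |d|], and both [G] and
    [lam * |d|] are controlled by the decrease that the step brings about,
    which cannot exceed [f x0 - fstar f].

    The logarithm of the gradient norm therefore serves as a potential: a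
    contraction lowers it by [- ln xi], a decrease step resets it to at most
    [potential_cap]. The logarithm of the penalty plays the same part for the
    rejections. The invariant [counts] carries both budgets through the run,
    and [iterations_le] reads the bound off from it. The method stops only at
    points with gradient norm below [eps] and with [lambda_min] above
    [- rho * eps^(1/2)], and [rho] is bounded. *)

(** * Euclidean geometry *)

Lemma le_of_eq {R : realType} (a b : R) : a = b -> a <= b.
Proof. by move=> ->. Qed.

Section Euclid.
Context {R : realType} {n : nat}.
Implicit Types (u v w : 'rV[R]_n) (A : 'M[R]_n) (a : R).

Lemma innerE u v : inner u v = \sum_i u ord0 i * v ord0 i.
Proof. by rewrite /inner !mxE; apply: eq_bigr => i _; rewrite !mxE. Qed.

Lemma innerC u v : inner u v = inner v u.
Proof. by rewrite !innerE; apply: eq_bigr => i _; rewrite mulrC. Qed.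

Lemma innerDl u v w : inner (u + v) w = inner u w + inner v w.
Proof. by rewrite /inner mulmxDl mxE. Qed.

Lemma innerZl a u w : inner (a *: u) w = a * inner u w.
Proof. by rewrite /inner -scalemxAl mxE. Qed.

Lemma innerNl u w : inner (- u) w = - inner u w.
Proof. by rewrite -scaleN1r innerZl mulN1r. Qed.

Lemma innerBl u v w : inner (u - v) w = inner u w - inner v w.
Proof. by rewrite innerDl innerNl. Qed.

Lemma innerDr u v w : inner u (v + w) = inner u v + inner u w.
Proof. by rewrite innerC innerDl !(innerC u). Qed.

Lemma innerZr a u w : inner u (a *: w) = a * inner u w.
Proof. by rewrite innerC innerZl innerC. Qed.

Lemma innerNr u w : inner u (- w) = - inner u w.
Proof. by rewrite innerC innerNl innerC. Qed.

Lemma innerBr u v w : inner u (v - w) = inner u v - inner u w.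
Proof. by rewrite innerDr innerNr. Qed.

Lemma inner0l u : inner 0 u = 0.
Proof. by rewrite -(scale0r 0) innerZl mul0r. Qed.

Lemma inner_ge0 v : 0 <= inner v v.
Proof. by rewrite innerE sumr_ge0 // => i _; rewrite -expr2 sqr_ge0. Qed.

Lemma l2norm_ge0 v : 0 <= l2norm v.
Proof. exact: sqrtr_ge0. Qed.

Lemma l2norm_sqr v : l2norm v ^+ 2 = inner v v.
Proof.
rewrite /l2norm sqr_sqrtr ?innerE; first exact: eq_bigr.
by rewrite sumr_ge0 // => i _; rewrite sqr_ge0.
Qed.

Lemma l2norm_def v : l2norm v = Num.sqrt (inner v v).
Proof. by rewrite -l2norm_sqr sqrtr_sqr ger0_norm ?l2norm_ge0. Qed.

Lemma inner_eq0 v : inner v v = 0 -> v = 0.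
Proof.
rewrite innerE => /eqP; rewrite psumr_eq0; last first.
  by move=> i _; rewrite -expr2 sqr_ge0.
move=> /allP h; apply/rowP => i; rewrite mxE.
by have := h i; rewrite mem_index_enum -expr2 sqrf_eq0 => /(_ isT) /eqP.
Qed.

Lemma l2norm_eq0 v : l2norm v = 0 -> v = 0.
Proof. by move=> h; apply: inner_eq0; rewrite -l2norm_sqr h expr0n. Qed.

Lemma l2norm0 : l2norm (0 : 'rV[R]_n) = 0.
Proof. by rewrite l2norm_def inner0l sqrtr0. Qed.

Lemma l2normZ a v : l2norm (a *: v) = `|a| * l2norm v.
Proof.
by rewrite !l2norm_def innerZl innerZr mulrA -expr2 sqrtrM ?sqr_ge0 // sqrtr_sqr.
Qed.

Lemma l2normN v : l2norm (- v) = l2norm v.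
Proof. by rewrite -scaleN1r l2normZ normrN1 mul1r. Qed.

(** Cauchy-Schwarz, from the nonnegativity of the square norm of
    [|v|^2 u - <u,v> v]. *)
Lemma inner_sqr_le u v : inner u v ^+ 2 <= inner u u * inner v v.
Proof.
have [v0|v0] := eqVneq (inner v v) 0.
  by rewrite (inner_eq0 v v0) innerC !inner0l expr0n mulr0.
have vp : 0 < inner v v by rewrite lt_def v0 inner_ge0.
have := inner_ge0 (inner v v *: u - inner u v *: v).
rewrite !(innerBl, innerBr, innerZl, innerZr) (innerC v u) => h.
rewrite -(ler_pM2l vp) -subr_ge0; apply: le_trans h _.
by apply: le_of_eq; ring.
Qed.

Lemma inner_le u v : `|inner u v| <= l2norm u * l2norm v.
Proof.
rewrite -ler_sqr ?nnegrE ?mulr_ge0 ?l2norm_ge0 // exprMn !l2norm_sqr.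
by rewrite real_normK ?num_real // inner_sqr_le.
Qed.

Lemma inner_ler u v : inner u v <= l2norm u * l2norm v.
Proof. exact: le_trans (ler_norm _) (inner_le u v). Qed.

Lemma ler_l2normD u v : l2norm (u + v) <= l2norm u + l2norm v.
Proof.
rewrite -ler_sqr ?nnegrE ?addr_ge0 ?l2norm_ge0 // l2norm_sqr.
rewrite !(innerDl, innerDr) (innerC v u) sqrrD !l2norm_sqr.
have := inner_ler u v; lra.
Qed.

Lemma opnorm_has_ubound A :
  has_ubound [set l2norm (v *m A) | v in [set v | l2norm v <= 1]].
Proof.
pose F := \sum_j l2norm (row j A^T) ^+ 2.
have F0 : 0 <= F by apply: sumr_ge0 => j _; rewrite sqr_ge0.
exists (Num.sqrt F) => _ [v /= v1 <-].
rewrite /l2norm ler_sqrt //; apply: ler_sum => j _.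
have -> : (v *m A) ord0 j = inner v (row j A^T).
  by rewrite innerE mxE; apply: eq_bigr => i _; rewrite !mxE.
apply: le_trans (inner_sqr_le _ _) _; rewrite -!l2norm_sqr.
rewrite -[leRHS]mul1r ler_wpM2r ?sqr_ge0 //.
by rewrite expr_le1 ?l2norm_ge0.
Qed.

Lemma l2norm_mulmx v A : l2norm (v *m A) <= opnorm A * l2norm v.
Proof.
have [v0|v0] := eqVneq (l2norm v) 0.
  by rewrite v0 (l2norm_eq0 v v0) mul0mx l2norm0 mulr0.
have vp : 0 < l2norm v by rewrite lt_def v0 l2norm_ge0.
rewrite -ler_pdivrMr //.
have -> : l2norm (v *m A) / l2norm v = l2norm (((l2norm v)^-1 *: v) *m A).
  by rewrite -scalemxAl l2normZ gtr0_norm ?invr_gt0 // mulrC.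
apply: ub_le_sup; first exact: opnorm_has_ubound.
by exists ((l2norm v)^-1 *: v) => //=; rewrite l2normZ gtr0_norm ?invr_gt0 // mulVf.
Qed.

Lemma quad_scalar a v : quad a%:M v = a * l2norm v ^+ 2.
Proof. by rewrite /quad mul_mx_scalar innerZl l2norm_sqr. Qed.

Lemma quadD A B v : quad (A + B) v = quad A v + quad B v.
Proof. by rewrite /quad mulmxDr innerDl. Qed.

Lemma eigenvalue_inner A a : eigenvalue A a ->
  exists2 v, v *m A = a *: v & 0 < inner v v.
Proof.
move=> /eigenvalueP[v vA v0]; exists v => //.
by rewrite lt_def inner_ge0 andbT; apply: contra_neq v0; exact: inner_eq0.
Qed.

End Euclid.

(** * Taylor expansions along a line *)

(** Comparing derivatives is how every Taylor bound below is obtained: the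
    remainder is dominated by a polynomial in the step length, so no integral
    is needed. *)
Lemma le_of_derive_le (R : realType) (u u' v v' : R -> R) :
  (forall t : R, is_derive t (1 : R) u (u' t)) ->
  (forall t : R, is_derive t (1 : R) v (v' t)) ->
  u 0 <= v 0 -> (forall t, 0 <= t -> u' t <= v' t) -> u 1 <= v 1.
Proof.
move=> du dv uv0 uv'.
have dw (t : R) : is_derive t (1 : R) (v - u) (v' t - u' t) by exact: is_deriveB.
have cw : {within `[0, 1], continuous (v - u)}.
  apply: continuous_subspaceT => s.
  by apply/differentiable_continuous/derivable1_diffP/ex_derive; exact: dw.
have [c + +] := MVT_segment ler01 (fun t _ => dw t) cw.
rewrite in_itv /= => /andP[c0 _]; rewrite !fctE subr0 mulr1 => h.
have := uv' c c0; lra.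
Qed.

Lemma is_derive_cubic (R : realType) (a b c e t : R) :
  is_derive t (1 : R) (fun s : R => a + b * s + c * s ^+ 2 + e * s ^+ 3)
    (b + 2 * c * t + 3 * e * t ^+ 2).
Proof.
by apply: is_derive_eq; rewrite !scaler1 /GRing.scale /=; ring.
Qed.

Section Lines.
Context {R : realType} {n : nat}.
Implicit Types (x d w : 'rV[R]_n) (t : R).

(** The library derivative along [d] differentiates [h |-> g (h *: d + y)] at 0;
    the comparison principle needs it at every point of the segment. *)
Lemma is_derive_line {W : normedModType R} (g : 'rV[R]_n -> W) x d t :
  differentiable g (x + t *: d) ->
  is_derive t (1 : R) (fun s => g (x + s *: d)) ('d g (x + t *: d) d).
Proof.
move=> dg.
have E : (fun h : R => h^-1 *: ((fun s => g (x + s *: d)) (h *: (1 : R) + t)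
              - g (x + t *: d))) =
         (fun h : R => h^-1 *: (g (h *: d + (x + t *: d)) - g (x + t *: d))).
  apply/funext => h; congr (_ *: (g _ - _)).
  by rewrite [h *: 1]mulr1 scalerDl addrCA.
apply: DeriveDef; first by rewrite /derivable E; exact: diff_derivable.
by rewrite -deriveE // /derive E.
Qed.

(** The inner product as a function of its left argument, in which it has to be
    registered as linear to be composed with differentials. *)
Definition innerr w (u : 'rV[R]_n) : R := inner u w.

Lemma innerr_is_linear w : linear (innerr w).
Proof. by move=> a u v; rewrite /innerr innerDl innerZl. Qed.

HB.instance Definition _ w :=
  GRing.isLinear.Build R 'rV[R]_n R _ (innerr w) (innerr_is_linear w).

Lemma innerr_continuous w : continuous (innerr w).
Proof.
have -> : innerr w = fun u : 'rV[R]_n => \sum_i u ord0 i * w ord0 i.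
  by apply/funext => u; rewrite /innerr innerE.
move=> u; apply: continuous_big => [|i _ {}u]; first exact: add_continuous.
by apply: continuousM; [exact: coord_continuous|exact: cst_continuous].
Qed.

Lemma is_derive_inner_line (g : 'rV[R]_n -> 'rV[R]_n) x d w t :
  differentiable g (x + t *: d) ->
  is_derive t (1 : R) (fun s => inner (g (x + s *: d)) w)
    (inner (d *m 'J g (x + t *: d)) w).
Proof.
move=> dg.
have dw y : differentiable (innerr w) y.
  by apply: linear_differentiable; exact: innerr_continuous.
have -> : inner (d *m 'J g (x + t *: d)) w =
          'd (innerr w \o g) (x + t *: d) d.
  rewrite diff_comp //= -deriveEjacobian // deriveE //.
  by rewrite diff_lin //; exact: innerr_continuous.
apply: (@is_derive_line _ (innerr w \o g)).
exact: differentiable_comp.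
Qed.

(** Expand the direction over the standard basis. *)
Lemma diff_grad (f : 'rV[R]_n -> R) x d :
  differentiable f x -> 'd f x d = inner (grad f x) d.
Proof.
move=> df; rewrite {1}(row_sum_delta d) linear_sum innerE.
apply: eq_bigr => i _; rewrite linearZ /= mxE deriveE //.
by rewrite mulrC.
Qed.

End Lines.

Section Taylor.
Context {R : realType} {n : nat} (f : 'rV[R]_n -> R) (M : R).
Hypothesis f2 : twice_differentiable f.
Hypothesis M0 : 0 <= M.
Hypothesis fM : lipschitz_hessian f M.
Implicit Types (x d u v w : 'rV[R]_n).

Lemma inner_hess_lipschitz x y u w :
  inner (u *m hess f x) w <=
  inner (u *m hess f y) w + M * l2norm (x - y) * l2norm u * l2norm w.
Proof.
rewrite -lerBlDl -innerBl -mulmxBr.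
apply: le_trans (inner_ler _ _) _; rewrite ler_wpM2r ?l2norm_ge0 //.
by apply: le_trans (l2norm_mulmx _ _) _; rewrite ler_wpM2r ?l2norm_ge0 ?fM.
Qed.

(** Stated against a test vector, so that the mean value theorem for real
    functions applies; the constant [M / 2] comes from integrating the bound
    [M * t * |d|^2 * |w|] of the variation of the derivative. *)
Lemma grad_taylor_inner x d w :
  inner (grad f (x + d)) w <=
  inner (grad f x) w + inner (d *m hess f x) w
    + M / 2 * l2norm d ^+ 2 * l2norm w.
Proof.
pose K := M / 2 * l2norm d ^+ 2 * l2norm w.
have := @le_of_derive_le R (fun t => inner (grad f (x + t *: d)) w) _
  (fun t => inner (grad f x) w + inner (d *m hess f x) w * t
            + K * t ^+ 2 + 0 * t ^+ 3) _
  (fun t => is_derive_inner_line _ _ _ _ _ (f2.2 _)) (is_derive_cubic _ _ _ _ _).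
rewrite scale1r scale0r addr0 !expr0n /= !mulr0 !addr0 !expr1n !mulr1 addr0.
apply => // t t0; rewrite mul0r addr0.
apply: le_trans (inner_hess_lipschitz _ x _ _) _.
rewrite (_ : x + _ - x = t *: d); last by rewrite addrC addKr.
rewrite l2normZ ger0_norm // lerD2l /K.
by apply: le_of_eq; field.
Qed.

(** Testing the remainder against itself turns the family of scalar bounds into
    a bound of its norm. *)
Lemma grad_taylor x d :
  l2norm (grad f (x + d) - grad f x - d *m hess f x) <= M / 2 * l2norm d ^+ 2.
Proof.
set r : 'rV[R]_n := _ - _ - _; have [r0|r0] := eqVneq (l2norm r) 0.
  by rewrite r0 mulr_ge0 ?divr_ge0 ?exprn_ge0 ?l2norm_ge0.
have rp : 0 < l2norm r by rewrite lt_def r0 l2norm_ge0.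
rewrite -(ler_pM2r rp) -expr2 (l2norm_sqr r).
have -> : inner r r = inner (grad f (x + d)) r - inner (grad f x) r
                      - inner (d *m hess f x) r by rewrite -!innerBl.
have := grad_taylor_inner x d r; lra.
Qed.

Lemma taylor_ge x d :
  f x + inner (grad f x) d + 2^-1 * quad (hess f x) d - M / 6 * l2norm d ^+ 3
  <= f (x + d).
Proof.
have := @le_of_derive_le R 
  (fun t => f x + inner (grad f x) d * t + 2^-1 * quad (hess f x) d * t ^+ 2
     + (- (M / 6 * l2norm d ^+ 3)) * t ^+ 3) _
  (fun t => f (x + t *: d)) _
  (is_derive_cubic _ _ _ _ _) (fun t => is_derive_line _ _ _ _ (f2.1 _)).
rewrite scale1r scale0r addr0 !expr0n /= !mulr0 !addr0 !expr1n !mulr1.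
apply => // t t0; rewrite diff_grad; last exact: f2.1.
have := grad_taylor_inner x (t *: d) (- d).
rewrite -scalemxAl !innerNr innerZl l2normZ l2normN ger0_norm // /quad.
rewrite exprMn.
set I0 := inner _ _; set I1 := inner _ _; set I2 := inner _ _.
move=> h; rewrite -lerN2; apply: le_trans h _.
by apply: le_of_eq; field.
Qed.

Lemma taylor_le x d :
  f (x + d) <=
  f x + inner (grad f x) d + 2^-1 * quad (hess f x) d + M / 6 * l2norm d ^+ 3.
Proof.
have := @le_of_derive_le R (fun t => f (x + t *: d)) _
  (fun t => f x + inner (grad f x) d * t + 2^-1 * quad (hess f x) d * t ^+ 2
     + M / 6 * l2norm d ^+ 3 * t ^+ 3) _
  (fun t => is_derive_line _ _ _ _ (f2.1 _)) (is_derive_cubic _ _ _ _ _).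
rewrite scale1r scale0r addr0 !expr0n /= !mulr0 !addr0 !expr1n !mulr1.
apply => // t t0; rewrite diff_grad; last exact: f2.1.
have := grad_taylor_inner x (t *: d) d.
rewrite -scalemxAl innerZl l2normZ ger0_norm // /quad exprMn.
set I0 := inner _ _; set I1 := inner _ _; set I2 := inner _ _.
move=> h; apply: le_trans h _.
by apply: le_of_eq; field.
Qed.

End Taylor.

(** * Symmetry of the Hessian *)

Lemma le0_of_le_small {R : realType} (a b : R) :
  (forall s, 0 < s -> a <= b * s) -> a <= 0.
Proof.
move=> h; rewrite leNgt; apply/negP => a0.
have b0 : 0 < b by have := h 1 ltr01; lra.
have := h (a / (2 * b)) (divr_gt0 a0 (mulr_gt0 (ltr0Sn _ 1) b0)).
rewrite (_ : b * _ = a / 2); last by field; rewrite gt_eqF.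
lra.
Qed.

(** The linear bookkeeping of the two estimates of [f (x + u + v)], with [F0],
    [F1], [F2] the values at [x], [x + u], [x + u + v], primes marking
    quantities taken at [x + u] and [e1], ..., [e4] the Taylor errors. *)
Lemma chain_upper {R : realType} (F0 F1 F2 gu gv gv' qu qv qv' b e1 e2 e3 e4 r : R) :
  e1 + e2 + e3 + 2^-1 * e4 <= r ->
  F2 <= F1 + gv' + 2^-1 * qv' + e1 -> F1 <= F0 + gu + 2^-1 * qu + e2 ->
  gv' <= gv + b + e3 -> qv' <= qv + e4 ->
  F2 <= F0 + gu + gv + b + 2^-1 * qu + 2^-1 * qv + r.
Proof. lra. Qed.

Lemma chain_lower {R : realType} (F0 F1 F2 gu gv gv' qu qv qv' b e1 e2 e3 e4 r : R) :
  e1 + e2 + e3 + 2^-1 * e4 <= r ->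
  F1 + gv' + 2^-1 * qv' - e1 <= F2 -> F0 + gu + 2^-1 * qu - e2 <= F1 ->
  - gv' <= - gv - b + e3 -> qv <= qv' + e4 ->
  F0 + gu + gv + b + 2^-1 * qu + 2^-1 * qv - r <= F2.
Proof. lra. Qed.

Section Symmetry.
Context {R : realType} {n : nat} (f : 'rV[R]_n -> R) (M : R).
Hypothesis f2 : twice_differentiable f.
Hypothesis M0 : 0 <= M.
Hypothesis fM : lipschitz_hessian f M.
Implicit Types (x d u v w : 'rV[R]_n).

Let rem u v : R := 2 * M * (l2norm u + l2norm v) ^+ 3.

Lemma remainder_le u v :
  M / 6 * l2norm v ^+ 3 + M / 6 * l2norm u ^+ 3
  + M / 2 * l2norm u ^+ 2 * l2norm v
  + 2^-1 * (M * l2norm u * l2norm v * l2norm v) <= rem u v.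
Proof.
rewrite /rem.
move: (l2norm u) (l2norm v) (l2norm_ge0 u) (l2norm_ge0 v) => a b a0 b0.
rewrite -subr_ge0.
have -> : 2 * M * (a + b) ^+ 3 -
   (M / 6 * b ^+ 3 + M / 6 * a ^+ 3 + M / 2 * a ^+ 2 * b +
    2^-1 * (M * a * b * b)) =
    M * (11 / 6 * a ^+ 3 + 11 / 6 * b ^+ 3 + 11 / 2 * (a ^+ 2 * b)
         + 11 / 2 * (a * b ^+ 2)) by field.
by rewrite mulr_ge0 // !addr_ge0 // !mulr_ge0 ?exprn_ge0.
Qed.

(** Go from [x] to [x + u] and then to [x + u + v]; moving the gradient and the
    Hessian from [x + u] back to [x] produces the bilinear term. *)
Lemma mixed_difference_le x u v :
  f (x + u + v) <= f x + inner (grad f x) u + inner (grad f x) v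
    + inner (u *m hess f x) v
    + 2^-1 * quad (hess f x) u + 2^-1 * quad (hess f x) v + rem u v.
Proof.
have t1 := taylor_le _ _ f2 fM (x + u) v.
have t2 := taylor_le _ _ f2 fM x u.
have t3 := grad_taylor_inner _ _ f2 fM x u v.
have t4 := inner_hess_lipschitz _ _ fM (x + u) x v v.
rewrite addrAC subrr add0r in t4.
exact: chain_upper (remainder_le u v) t1 t2 t3 t4.
Qed.

Lemma mixed_difference_ge x u v :
  f x + inner (grad f x) u + inner (grad f x) v
    + inner (u *m hess f x) v
    + 2^-1 * quad (hess f x) u + 2^-1 * quad (hess f x) v - rem u v
  <= f (x + u + v).
Proof.
have t1 := taylor_ge _ _ f2 fM (x + u) v.
have t2 := taylor_ge _ _ f2 fM x u.
have t3 := grad_taylor_inner _ _ f2 fM x u (- v).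
have t4 := inner_hess_lipschitz _ _ fM x (x + u) v v.
rewrite opprD addrA subrr add0r l2normN in t4.
rewrite !innerNr l2normN in t3.
exact: chain_lower (remainder_le u v) t1 t2 t3 t4.
Qed.

(** The lower estimate for the path through [x + u] meets the upper estimate for
    the path through [x + v]; the terms that are not bilinear cancel. *)
Lemma hess_sym_le x u v : inner (u *m hess f x) v <= inner (v *m hess f x) u.
Proof.
rewrite -subr_le0; apply: (le0_of_le_small _ (2 * rem u v)) => s s0.
have h1 := mixed_difference_ge x (s *: u) (s *: v).
have := mixed_difference_le x (s *: v) (s *: u).
rewrite -addrA (addrC (s *: v)) addrA => h2.
have {h1 h2} := le_trans h1 h2.
have -> : rem (s *: u) (s *: v) = s ^+ 3 * rem u v.
  by rewrite /rem !l2normZ gtr0_norm // -mulrDr exprMn; ring.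
have -> : rem (s *: v) (s *: u) = s ^+ 3 * rem u v.
  by rewrite /rem !l2normZ gtr0_norm // -mulrDr exprMn (addrC (l2norm v)); ring.
rewrite -!scalemxAl !innerZl !innerZr => h.
rewrite -(ler_pM2l (exprn_gt0 2 s0)).
have -> : s ^+ 2 * (2 * rem u v * s) = 2 * (s ^+ 3 * rem u v) by ring.
rewrite mulrBr expr2 -!mulrA; lra.
Qed.

(** Schwarz's theorem: both orders of expanding [f (x + u + v)] agree up to a
    remainder of order three, which vanishes against the bilinear terms when
    [u] and [v] are scaled down. *)
Lemma hess_sym x u v : inner (u *m hess f x) v = inner (v *m hess f x) u.
Proof. by apply/eqP; rewrite eq_le !hess_sym_le. Qed.

End Symmetry.

(** * The smallest eigenvalue *)

Section Rayleigh.
Context {R : realType} {n : nat}.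
Implicit Types (A : 'M[R]_n) (u v w : 'rV[R]_n).

Lemma continuous_inner (g h : 'rV[R]_n -> 'rV[R]_n) :
  (forall i, continuous (fun v => g v ord0 i)) ->
  (forall i, continuous (fun v => h v ord0 i)) ->
  continuous (fun v => inner (g v) (h v)).
Proof.
move=> cg ch.
have -> : (fun v => inner (g v) (h v)) =
    fun v : 'rV[R]_n => \sum_i g v ord0 i * h v ord0 i.
  by apply/funext => u; rewrite innerE.
apply: continuous_big => [|i _ u]; first exact: add_continuous.
by apply: continuousM; [exact: cg|exact: ch].
Qed.

Lemma continuous_quad A : continuous (quad A).
Proof.
apply: continuous_inner => i; last exact: coord_continuous.
have -> : (fun v : 'rV[R]_n => (v *m A) ord0 i) = innerr (row i A^T).
  apply/funext => v; rewrite /innerr innerE mxE.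
  by apply: eq_bigr => j _; rewrite !mxE.
exact: innerr_continuous.
Qed.

Lemma coord_le_l2norm v i : `|v ord0 i| <= l2norm v.
Proof.
rewrite -sqrtr_sqr /l2norm ler_sqrt; last first.
  by apply: sumr_ge0 => j _; rewrite sqr_ge0.
by rewrite (bigD1 i) //= lerDl sumr_ge0 // => j _; rewrite sqr_ge0.
Qed.

Lemma compact_sphere : compact [set v : 'rV[R]_n | inner v v = 1].
Proof.
apply: bounded_closed_compact.
  exists 1; split=> [|y y1 v /= v1]; first exact: num_real.
  rewrite /Num.norm /= mx_normrE; apply: bigmax_le => [|[i j] _ /=].
    by rewrite ltW // (lt_trans ltr01).
  rewrite ord1; apply: le_trans (coord_le_l2norm v j) _.
  by rewrite l2norm_def v1 sqrtr1 ltW.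
have -> : [set v : 'rV[R]_n | inner v v = 1] =
          (fun v => inner v v) @^-1` [set 1] by [].
apply: closed_comp => [v _|]; last exact: closed_eq.
by apply: continuous_inner => i; exact: coord_continuous.
Qed.

(** A minimizer of the quadratic form on the unit sphere is an eigenvector: the
    form minus its minimum is nonnegative, vanishes there, and so has no linear
    part there. *)
Lemma quad_ge_lambda_min A v : (forall u w, inner (u *m A) w = inner (w *m A) u) ->
  lambda_min A * l2norm v ^+ 2 <= quad A v.
Proof.
move=> symA; rewrite l2norm_sqr.
have [v0|v0] := eqVneq (inner v v) 0.
  by rewrite (inner_eq0 _ v0) /quad mul0mx !inner0l mulr0.
have normalize u : inner u u != 0 -> 
    inner ((l2norm u)^-1 *: u) ((l2norm u)^-1 *: u) = 1.
  move=> u0; rewrite innerZl innerZr mulrA -l2norm_sqr -expr2 exprVn mulVf //.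
  by rewrite l2norm_sqr.
have [c /set_mem /= c1 cmin] : exists2 c, c \in [set v : 'rV[R]_n | inner v v = 1]
    & forall t, t \in [set v : 'rV[R]_n | inner v v = 1] -> quad A c <= quad A t.
  apply: EVT_min_rV; first by exists ((l2norm v)^-1 *: v); exact: normalize.
    exact: compact_sphere.
  exact/continuous_subspaceT/continuous_quad.
set m := quad A c in cmin.
have ge_m u : m * inner u u <= quad A u.
  have [u0|u0] := eqVneq (inner u u) 0.
    by rewrite (inner_eq0 _ u0) /quad mul0mx !inner0l mulr0.
  have := cmin _ (mem_set (normalize u u0)).
  rewrite /quad -scalemxAl innerZl innerZr mulrA -expr2 exprVn l2norm_sqr.
  by rewrite ler_pdivlMl ?lt_def ?u0 ?inner_ge0 // mulrC.
have eig : c *m A = m *: c.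
  apply/eqP; rewrite -subr_eq0; apply/eqP; apply: inner_eq0.
  have [r rE] : {r | r = c *m A - m *: c} by exists (c *m A - m *: c).
  rewrite -rE; have lin s : 0 < s -> 2 * inner r r <= (quad A r - m * inner r r) * s.
    move=> s0; have := ge_m (c - s *: r).
    have -> : quad A (c - s *: r) =
        m - 2 * s * inner (c *m A) r + s ^+ 2 * quad A r.
      rewrite /m /quad mulmxBl -scalemxAl !(innerBl, innerBr, innerZl, innerZr).
      by rewrite (symA r c); ring.
    rewrite !(innerBl, innerBr, innerZl, innerZr) c1 (innerC r c) => h.
    rewrite -(ler_pM2l s0).
    have -> : s * (2 * inner r r) = s * (2 * (inner (c *m A) r - m * inner c r)).
      by rewrite {1}rE innerBl innerZl.
    lra.
  apply/eqP; rewrite eq_le inner_ge0 andbT.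
  by have := le0_of_le_small _ _ lin; lra.
have me : eigenvalue A m.
  apply/eigenvalueP; exists c => //; apply/eqP => c0.
  by move: c1; rewrite c0 inner0l => /eqP; rewrite eq_sym oner_eq0.
apply: le_trans (ge_m v); rewrite ler_wpM2r ?inner_ge0 //.
apply: ge_inf => //; exists m => a /= /eigenvalue_inner[w wA w0].
by have := ge_m w; rewrite /quad wA innerZl ler_pM2r.
Qed.

(** If there were no eigenvalue, then [lambda_min A] would be the infimum of
    the empty set, which is zero. *)
Lemma ler_lambda_min A b :
  lambda_min A < 0 -> psd (A + b%:M) -> - b <= lambda_min A.
Proof.
move=> neg pA; apply: lb_le_inf.
  apply/set0P/eqP => E; by move: neg; rewrite /lambda_min E inf0 ltxx.
move=> a /= /eigenvalue_inner[w wA w0].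
have := pA w; rewrite quadD quad_scalar /quad wA innerZl l2norm_sqr -mulrDl.
by rewrite pmulr_lge0 // -lerBlDr sub0r.
Qed.

End Rayleigh.

Section Scalar.
Context {R : realType}.
Implicit Types (M rho s D a eta xi : R).

Lemma powR32 a : 0 <= a -> a `^ (3 / 2) = Num.sqrt a ^+ 3.
Proof.
move=> a0; rewrite -powR_mulrn ?sqrtr_ge0 // -powR12_sqrt // -powRrM.
by congr powR; field.
Qed.

(** * Scalar estimates for one step *)

(** Below, [s] is the square root of the gradient scale, [D] the length of the
    step, [rho * s] the curvature of the model along it, and the multiples of
    [M] are the Taylor errors. *)
Lemma interior_decrease M rho s D : 0 < rho -> 0 <= D <= s / (2 * rho) ->
  M <= 6 * rho ^+ 2 -> - (2^-1 * (rho * s) * D ^+ 2) + M / 6 * D ^+ 3 <= 0.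
Proof.
move=> r0 /andP[D0 Ds] Mr.
have -> : - (2^-1 * (rho * s) * D ^+ 2) + M / 6 * D ^+ 3 =
  - (D ^+ 2 * (2^-1 * (rho * s) - M / 6 * D)) by ring.
rewrite oppr_le0 mulr_ge0 ?exprn_ge0 // subr_ge0.
have h1 : M / 6 * D <= rho ^+ 2 * D by rewrite ler_wpM2r //; lra.
have h2 : rho ^+ 2 * D <= rho ^+ 2 * (s / (2 * rho)).
  by rewrite ler_wpM2l ?sqr_ge0.
apply: le_trans h1 (le_trans h2 _).
by apply: le_of_eq; field; rewrite gt_eqF.
Qed.

(** A step that ends on the boundary has a length proportional to [s], so that
    the model decrease and the Taylor error are both multiples of [s ^+ 3 / rho];
    the condition on [rho] leaves the multiple [eta]. *)
Lemma boundary_decrease M rho s eta (k : R) : 0 < rho -> 0 < k -> 0 <= s ->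
  M <= 3 * k * (1 - 2 * k ^+ 2 * eta) * rho ^+ 2 ->
  - (2^-1 * (rho * s) * (s / (k * rho)) ^+ 2) + M / 6 * (s / (k * rho)) ^+ 3
    <= - (eta / rho * s ^+ 3).
Proof.
move=> r0 k0 s0 Mr.
have kr : 0 < k * rho by rewrite mulr_gt0.
have h : M / 6 * (s / (k * rho)) ^+ 3 <=
    (3 * k * (1 - 2 * k ^+ 2 * eta) * rho ^+ 2) / 6 * (s / (k * rho)) ^+ 3.
  rewrite ler_wpM2r ?exprn_ge0 ?divr_ge0 ?(ltW kr) //; lra.
apply: le_trans (lerD (lexx _) h) _.
apply: le_of_eq; field.
by rewrite !gt_eqF.
Qed.

Lemma curvature_error_le M rho s D k c : 0 < rho -> 0 < k ->
  0 <= D <= s / (k * rho) -> 0 <= M <= 2 * k ^+ 2 * c * rho ^+ 2 ->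
  M / 2 * D ^+ 2 <= c * s ^+ 2.
Proof.
move=> r0 k0 /andP[D0 Ds] /andP[M0 Mr].
have h1 : M / 2 * D ^+ 2 <= M / 2 * (s / (k * rho)) ^+ 2.
  by rewrite ler_wpM2l ?divr_ge0 // ler_sqr ?nnegrE ?(le_trans D0 Ds).
have h2 : M / 2 * (s / (k * rho)) ^+ 2 <=
    (2 * k ^+ 2 * c * rho ^+ 2) / 2 * (s / (k * rho)) ^+ 2.
  by rewrite ler_wpM2r ?sqr_ge0 //; lra.
apply: le_trans h1 (le_trans h2 _).
by apply: le_of_eq; field; rewrite !gt_eqF.
Qed.

End Scalar.

(** * One step of the method *)

Section Step.
Context {R : realType} {n : nat} (f : 'rV[R]_n -> R) (M : R).
Hypothesis f2 : twice_differentiable f.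
Hypothesis M0 : 0 <= M.
Hypothesis fM : lipschitz_hessian f M.
Implicit Types (x d : 'rV[R]_n) (sigma radius lam : R).

Lemma solution_radius x sigma radius d lam :
  subproblem_solution f x sigma radius d lam -> 0 < lam -> l2norm d = radius.
Proof.
move=> [_ [_ h _ _]] l0; apply/eqP; rewrite -subr_eq0.
by move/eqP: h; rewrite mulf_eq0 gt_eqF.
Qed.

Lemma shift_hess_quad x sigma lam d :
  quad (reg_hess f x sigma + lam%:M) d =
  quad (hess f x) d +
    (sigma * Num.sqrt (l2norm (grad f x)) + lam) * l2norm d ^+ 2.
Proof. by rewrite /reg_hess !quadD !quad_scalar mulrDl addrA. Qed.

(** The optimality condition turns [inner (grad f x) d] into minus the shifted
    quadratic form; the second-order term gives half of the Hessian part
    back. *)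
Lemma solution_decrease x sigma radius d lam :
  subproblem_solution f x sigma radius d lam ->
  f (x + d) - f x <=
  - (2^-1 * quad (hess f x) d)
  - (sigma * Num.sqrt (l2norm (grad f x)) + lam) * l2norm d ^+ 2
  + M / 6 * l2norm d ^+ 3.
Proof.
move=> [_ [_ _ opt _]].
have E : inner (grad f x) d = - (quad (hess f x) d +
    (sigma * Num.sqrt (l2norm (grad f x)) + lam) * l2norm d ^+ 2).
  by rewrite -shift_hess_quad /quad opt innerNl opprK.
have := taylor_le _ _ f2 fM x d; rewrite E; lra.
Qed.

Lemma solution_curvature x sigma radius d lam :
  subproblem_solution f x sigma radius d lam ->
  0 <= quad (hess f x) d +
    (sigma * Num.sqrt (l2norm (grad f x)) + lam) * l2norm d ^+ 2.
Proof. by move=> [_ [_ _ _ /(_ d)]]; rewrite shift_hess_quad. Qed.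

(** By optimality the linearized gradient at the new point is a multiple of the
    step, so only the Taylor error adds to it. *)
Lemma solution_grad x sigma radius d lam : 0 <= sigma ->
  subproblem_solution f x sigma radius d lam ->
  l2norm (grad f (x + d)) <=
  (sigma * Num.sqrt (l2norm (grad f x)) + lam) * l2norm d
  + M / 2 * l2norm d ^+ 2.
Proof.
move=> s0 [_ [l0 _ opt _]].
set c := _ + lam.
have c0 : 0 <= c by rewrite addr_ge0 // mulr_ge0 // sqrtr_ge0.
have E : grad f x + d *m hess f x = - (c *: d).
  have h : d *m hess f x + c *: d = - grad f x.
    by rewrite -opt /reg_hess !mulmxDr !mul_mx_scalar scalerDl addrA.
  by apply/eqP; rewrite -addr_eq0 -addrA h subrr.
have -> : grad f (x + d) =
    (grad f (x + d) - grad f x - d *m hess f x) - c *: d.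
  by rewrite -E -[_ - _ - _]addrA -opprD subrK.
apply: le_trans (ler_l2normD _ _) _.
rewrite l2normN l2normZ ger0_norm // addrC lerD2l.
exact: grad_taylor.
Qed.


Section Method.
Variables (p : params R) (eps : R).
Hypothesis eps0 : 0 < eps.

(** The scale that replaces the gradient norm once it is below the tolerance:
    with it the two regimes of the method obey the same estimates. *)
Let gmax x : R := Num.max (l2norm (grad f x)) eps.

Lemma gmax_gt0 x : 0 < gmax x.
Proof. by rewrite lt_max eps0 orbT. Qed.

Lemma strategy_bounds x rho sigma radius : 0 < rho ->
  strategy f eps x rho = (sigma, radius) ->
  [/\ 0 <= sigma, Num.sqrt (gmax x) / (4 * rho) <= radius
    & radius <= Num.sqrt (gmax x) / (2 * rho)].
Proof.
move=> r0; rewrite /strategy /gmax.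
have r4 : (4 * rho)^-1 <= (2 * rho)^-1.
  by rewrite lef_pV2 ?posrE ?mulr_gt0 // ler_pM2r // ler_nat.
have le_half (s : R) : 0 <= s -> s / (4 * rho) <= s / (2 * rho).
  by move=> s0; rewrite ler_wpM2l.
have [ge|ge] := leP eps (l2norm (grad f x)).
  by case: ifP => _ [<- <-]; split; rewrite // ?(ltW r0) // [_^-1 * _]mulrC ?lexx //
    le_half // sqrtr_ge0.
by move=> [<- <-]; split => //; rewrite le_half ?sqrtr_ge0.
Qed.

Lemma acceptedP x rho d lam :
  accepted p f eps x rho d lam <->
  [/\ f (x + d) <= f x,
      f (x + d) - f x <= - (Defs.eta p / rho * Num.sqrt (gmax x) ^+ 3) \/
      eps <= l2norm (grad f x) /\
      l2norm (grad f (x + d)) <= xi p * l2norm (grad f x)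
    & l2norm (grad f (x + d)) <= xi p * gmax x + lam * l2norm d].
Proof.
rewrite /accepted /gmax; have [ge|ge] := leP eps (l2norm (grad f x)).
  rewrite powR32 ?l2norm_ge0 //; split.
    by move=> /andP[-> /andP[/orP h ->]]; split => //; case: h; [left|right].
  by move=> [-> h ->]; rewrite andbT /=; apply/orP; case: h => [|[]]; [left|right].
rewrite powR32 ?(ltW eps0) //; split.
  by move=> /andP[-> /andP[-> ->]]; split => //; left.
by move=> [-> [-> ->//|[]]].
Qed.

Section Acceptance.
Variables (x d : 'rV[R]_n) (rho lam : R).
Hypothesis rho0 : 0 < rho.
Hypothesis large2 : M <= 6 * (1 - 8 * Defs.eta p) * rho ^+ 2.
Hypothesis large4 : M <= 12 * (1 - 32 * Defs.eta p) * rho ^+ 2.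
Hypothesis xi2 : M <= 8 * xi p * rho ^+ 2.
Hypothesis xi4 : M <= (32 * xi p - 8) * rho ^+ 2.
Hypothesis eta0 : 0 < Defs.eta p.

Let s := Num.sqrt (gmax x).

Let s_gt0 : 0 < s.
Proof. by rewrite sqrtr_gt0 gmax_gt0. Qed.

Let s_sqr : s ^+ 2 = gmax x.
Proof. by rewrite sqr_sqrtr // ltW // gmax_gt0. Qed.

(** The part of the acceptance test shared by all branches of the strategy. On
    the boundary, where the multiplier may be positive, the decrease of [f] is
    sufficient; in the interior the multiplier vanishes and the gradient bound
    already is a contraction. The factor [k] is 2 or 4, as in the radius. *)
Lemma accepted_of_bounds k :
  2 <= k -> M <= 3 * k * (1 - 2 * k ^+ 2 * Defs.eta p) * rho ^+ 2 ->
  l2norm d <= s / (k * rho) ->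
  f (x + d) - f x <=
    - (2^-1 * (rho * s) * l2norm d ^+ 2) + M / 6 * l2norm d ^+ 3 ->
  l2norm (grad f (x + d)) <= xi p * gmax x + lam * l2norm d ->
  0 <= lam -> (0 < lam -> l2norm d = s / (k * rho)) ->
  eps <= l2norm (grad f x) \/ 0 < lam ->
  accepted p f eps x rho d lam.
Proof.
move=> k2 Mk Dk df g' lam0 lamD alt.
have k0 : 0 < k by apply: lt_le_trans k2.
have D2 : l2norm d <= s / (2 * rho).
  apply: le_trans Dk _; rewrite ler_wpM2l ?(ltW s_gt0) //.
  by rewrite lef_pV2 ?posrE ?mulr_gt0 // ler_pM2r.
have M6 : M <= 6 * rho ^+ 2.
  apply: le_trans large2 _; rewrite ler_wpM2r ?sqr_ge0 //; move: eta0; lra.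
apply/acceptedP; split=> //.
  rewrite -subr_le0; apply: le_trans df _; apply: interior_decrease => //.
  by rewrite l2norm_ge0.
have [l0|l0] := ltP 0 lam.
  left; apply: le_trans df _; rewrite lamD //.
  by apply: boundary_decrease => //; exact: ltW.
have {}l0 : lam = 0 by apply/eqP; rewrite eq_le l0.
case: alt => [ge|]; last by rewrite l0 ltxx.
right; split => //; move: g'; rewrite l0 mul0r addr0 /gmax.
by move/max_idPl: ge => ->.
Qed.

(** The shifted Hessian is positive semidefinite, so the multiplier has to make
    up for the negative curvature. *)
Lemma multiplier_ge t radius : 0 < t -> lambda_min (hess f x) <= - (rho * t) ->
  subproblem_solution f x 0 radius d lam -> rho * t <= lam.
Proof.
move=> t0 neg [_ [_ _ _ psdl]]; rewrite -lerN2.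
apply: (le_trans _ neg).
apply: ler_lambda_min.
  by apply: (le_lt_trans neg); rewrite oppr_lt0 mulr_gt0.
by move=> v; move: (psdl v); rewrite /reg_hess mul0r raddf0 addr0.
Qed.

(** A large penalty is always accepted. The model curves by at least
    [rho * s] along the step for a different reason in each branch: the
    multiplier (negative curvature), the Hessian itself (strong convexity), or
    the regularization. *)
Lemma accepted_of_large sigma radius :
  ~~ terminated f eps x rho ->
  strategy f eps x rho = (sigma, radius) ->
  subproblem_solution f x sigma radius d lam ->
  accepted p f eps x rho d lam.
Proof.
have M2 : M <= 3 * 2 * (1 - 2 * 2 ^+ 2 * Defs.eta p) * rho ^+ 2.
  apply: le_trans large2 _.
  by apply: le_of_eq; ring.
have M4 : M <= 3 * 4 * (1 - 2 * 4 ^+ 2 * Defs.eta p) * rho ^+ 2.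
  apply: le_trans large4 _.
  by apply: le_of_eq; ring.
have Mx : 0 <= M <= 2 * 2 ^+ 2 * xi p * rho ^+ 2.
  rewrite M0; apply: le_trans xi2 _.
  by apply: le_of_eq; ring.
have Mx4 : 0 <= M <= 2 * 4 ^+ 2 * (xi p - 4^-1) * rho ^+ 2.
  rewrite M0; apply: le_trans xi4 _.
  by apply: le_of_eq; field.
have D0 := l2norm_ge0 d.
(* The unregularized step, whatever makes the model curve by [rho * s]. *)
have plain : subproblem_solution f x 0 (s / (2 * rho)) d lam ->
    rho * s <= lam \/ rho * s <= lambda_min (hess f x) ->
    eps <= l2norm (grad f x) \/ 0 < lam -> accepted p f eps x rho d lam.
  move=> sol curv alt.
  have [[Dr _] [l0 _ _ _]] := sol.
  apply: (accepted_of_bounds 2) => //.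
  - apply: le_trans (solution_decrease _ _ _ _ _ sol) _.
    have := solution_curvature _ _ _ _ _ sol.
    rewrite mul0r add0r lerD2r => q0.
    have D2 := exprn_ge0 2 D0.
    have : rho * s * l2norm d ^+ 2 <= lam * l2norm d ^+ 2 \/
           rho * s * l2norm d ^+ 2 <= quad (hess f x) d.
      case: curv => h; [left|right]; first by rewrite ler_wpM2r.
      apply: le_trans (quad_ge_lambda_min _ _ _).
        by rewrite ler_wpM2r.
      exact: hess_sym f2 M0 fM x.
    have := mulr_ge0 l0 D2.
    have -> : 2^-1 * (rho * s) * l2norm d ^+ 2 =
              2^-1 * (rho * s * l2norm d ^+ 2) by rewrite -[LHS]mulrA.
    move: q0; move: (rho * s * _) (lam * _) (quad _ _) => a b c q0 b0 [] ?; lra.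
  - apply: le_trans (solution_grad _ _ _ _ _ (lexx 0) sol) _.
    rewrite mul0r add0r addrC lerD2r -s_sqr.
    by apply: (@curvature_error_le _ _ rho _ _ 2) => //; rewrite D0.
  - exact: solution_radius sol.
have s_g : eps <= l2norm (grad f x) -> s = Num.sqrt (l2norm (grad f x)).
  by move=> ge; rewrite /s /gmax; move/max_idPl: ge => ->.
rewrite /terminated /strategy; have [ge _|lt] := leP eps (l2norm (grad f x)).
  rewrite -s_g //; case: ifP => [curv|_] [<- <-] sol.
    rewrite mulrC in sol; apply: plain => //; last by left.
    case/orP: curv => curv; [left|by right].
    exact: multiplier_ge sol.
  rewrite mulrC in sol.
  have [[Dr _] [l0 _ _ _]] := sol.
  apply: (accepted_of_bounds 4) => //.
  - by rewrite ler_nat.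
  - apply: le_trans (solution_decrease _ _ _ _ _ sol) _.
    have := solution_curvature _ _ _ _ _ sol; rewrite -s_g // lerD2r.
    have := mulr_ge0 l0 (exprn_ge0 2 D0).
    have -> : 2^-1 * (rho * s) * l2norm d ^+ 2 =
              2^-1 * (rho * s * l2norm d ^+ 2) by rewrite -[LHS]mulrA.
    rewrite mulrDl; move: (rho * s * _) (lam * _) (quad _ _) => a b c; lra.
  - apply: le_trans (solution_grad _ _ _ _ _ (ltW rho0) sol) _.
    rewrite -s_g // mulrDl addrAC lerD2r -s_sqr.
    have e : M / 2 * l2norm d ^+ 2 <= (xi p - 4^-1) * s ^+ 2.
      by apply: (curvature_error_le M rho s _ 4) => //; rewrite D0.
    have e' : rho * s * l2norm d <= s ^+ 2 / 4.
      apply: (@le_trans _ _ (rho * s * (s / (4 * rho)))).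
        by rewrite ler_wpM2l ?mulr_ge0 ?(ltW rho0) ?(ltW s_gt0).
      by apply: le_of_eq; field; rewrite gt_eqF.
    move: e e'; move: (M / 2 * _) (s ^+ 2) (rho * _ * _) => a b c; lra.
  - exact: solution_radius sol.
  - by left.
rewrite /= -leNgt => curv [<- <-] sol.
have s_e : s = Num.sqrt eps by rewrite /s /gmax; move/ltW/max_idPr: lt => ->.
rewrite -s_e in sol.
have h := multiplier_ge _ _ s_gt0 _ sol; rewrite s_e in h.
have {}h := h curv.
by apply: plain => //; [left; rewrite s_e|right; rewrite (lt_le_trans _ h) // mulr_gt0 // sqrtr_gt0].
Qed.

End Acceptance.

(** A positive multiplier puts the step on the boundary, and then lowers the
    model by at least [lam * |d|^2 / 2], which the gap to the infimum of [f]
    and the Taylor error bound. *)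
Lemma multiplier_le x rho d sigma radius lam (Delta : R) : 0 < rho -> 0 <= Delta ->
  strategy f eps x rho = (sigma, radius) ->
  subproblem_solution f x sigma radius d lam ->
  f x - f (x + d) <= Delta ->
  lam * l2norm d <=
  8 * rho * Delta / Num.sqrt (gmax x) + M / (12 * rho ^+ 2) * gmax x.
Proof.
move=> rho0 De0 S sol drop.
have [sg0 r1 r2] := strategy_bounds x rho sigma radius rho0 S.
have [_ [l0 _ _ _]] := sol.
have s0 : 0 < Num.sqrt (gmax x) by rewrite sqrtr_gt0 gmax_gt0.
have e : gmax x = Num.sqrt (gmax x) ^+ 2.
  by rewrite sqr_sqrtr // ltW // gmax_gt0.
rewrite [X in _ + _ * X]e; move: (Num.sqrt (gmax x)) s0 r1 r2 {e} => s s0 r1 r2.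
move: l0; rewrite le_eqVlt => /orP[/eqP <-|l0].
  by rewrite mul0r addr_ge0 // !mulr_ge0 ?invr_ge0 ?mulr_ge0 ?sqr_ge0 // ltW.
have Dr := solution_radius _ _ _ _ _ sol l0.
rewrite -Dr in r1 r2.
have D0 : 0 < l2norm d by apply: (lt_le_trans _ r1); rewrite divr_gt0 ?mulr_gt0.
have main : lam * l2norm d ^+ 2 <= 2 * Delta + M / 3 * l2norm d ^+ 3.
  have := solution_decrease _ _ _ _ _ sol.
  have := solution_curvature _ _ _ _ _ sol.
  have : 0 <= sigma * Num.sqrt (l2norm (grad f x)) * l2norm d ^+ 2.
    by rewrite !mulr_ge0 ?sqrtr_ge0 ?sqr_ge0.
  have -> : M / 3 * l2norm d ^+ 3 = 2 * (M / 6 * l2norm d ^+ 3) by field.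
  rewrite mulrDl; move: drop.
  move: (f x) (f (x + d)) (sigma * _ * _) (lam * _) (quad _ _) (M / 6 * _).
  by move=> *; lra.
move: (l2norm d) D0 r1 r2 main => D D0 r1 r2 main.
have {main} : lam * D <= 2 * Delta / D + M / 3 * D ^+ 2.
  rewrite -(ler_pM2r D0).
  have -> : lam * D * D = lam * D ^+ 2 by ring.
  have -> // : (2 * Delta / D + M / 3 * D ^+ 2) * D = 2 * Delta + M / 3 * D ^+ 3.
  by field; rewrite gt_eqF.
move=> h; apply: (le_trans h); apply: lerD.
  have -> : 8 * rho * Delta / s = 2 * Delta * (4 * rho / s) by ring.
  rewrite ler_wpM2l ?mulr_ge0 // -[4 * rho / s]invrK invf_div.
  by rewrite lef_pV2 ?posrE ?divr_gt0 ?mulr_gt0.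
have -> : M / (12 * rho ^+ 2) * s ^+ 2 = M / 3 * (s / (2 * rho)) ^+ 2.
  by field; rewrite gt_eqF.
by rewrite ler_wpM2l ?divr_ge0 // ler_sqr ?nnegrE ?(ltW D0) // (le_trans _ r2) ?ltW.
Qed.

End Method.
End Step.

(** * Penalties and the bound of the gradient *)

Section Reals.
Context {R : realType}.
Implicit Types (M a rho k Y s : R).

Lemma le_of_sqrt_div_le M a rho :
  0 <= M -> 0 < a -> 0 < rho -> Num.sqrt (M / a) <= rho -> M <= a * rho ^+ 2.
Proof.
move=> M0 a0 r0 h; rewrite mulrC -ler_pdivrMr //.
rewrite -[leLHS]sqr_sqrtr ?divr_ge0 ?(ltW a0) //.
by rewrite ler_sqr ?nnegrE ?sqrtr_ge0 ?(ltW r0).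
Qed.

Lemma sqr_le_powR23 k Y s : 1 <= k -> 0 <= Y -> 0 <= s ->
  s ^+ 3 <= k * Y -> s ^+ 2 <= k * Y `^ (2 / 3).
Proof.
move=> k1 Y0 s0 h; have k0 : 0 <= k by apply: le_trans k1.
have -> : s ^+ 2 = (s ^+ 3) `^ (2 / 3).
  by rewrite -!powR_mulrn // -powRrM; congr powR; field.
apply: (@le_trans _ _ ((k * Y) `^ (2 / 3))).
  by rewrite ge0_ler_powR ?nnegrE ?exprn_ge0 ?mulr_ge0 // divr_ge0.
rewrite powRM // ler_wpM2r ?powR_ge0 // ler1_powR //; lra.
Qed.

End Reals.

Section Penalties.
Context {R : realType}.
Variables (p : params R) (M : R).
Hypothesis hp : valid_params p.
Hypothesis M0 : 0 < M.

Lemma large_of_rho_max rho : 0 < rho -> rho_max p M <= gamma1 p * rho ->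
  [/\ M <= 6 * (1 - 8 * Defs.eta p) * rho ^+ 2,
      M <= 12 * (1 - 32 * Defs.eta p) * rho ^+ 2,
      M <= 8 * xi p * rho ^+ 2 & M <= (32 * xi p - 8) * rho ^+ 2].
Proof.
move=> r0; have [/andP[e0 e1] /andP[x0 x1] _ _ [g1 _]] := hp.
rewrite /rho_max ler_pM2l ?(lt_trans ltr01) // !ge_max.
move=> /andP[h1 /andP[h2 /andP[h3 /andP[h4 _]]]].
split; apply: le_of_sqrt_div_le (ltW M0) _ r0 _ => //; lra.
Qed.

(** These two factors absorb an initial penalty outside of the range between
    [rho_min] and [rho_max], and [grad_factor] is the resulting loss in the
    bound of the gradient; none of them depends on the function. *)
Definition init_excess : R := Num.max 1 (rho_init p / rho_min p).
Definition init_deficit : R := Num.max 1 ((rho_min p / rho_init p) ^+ 2).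
Definition grad_factor : R := 2 * init_excess * init_deficit.

Definition rho_hat : R := Num.max (rho_init p) (rho_max p M).
Definition rho_low : R := Num.min (rho_init p) (rho_min p).

Hypothesis rho_lt : rho_min p < rho_max p M.

Let rmin0 : 0 < rho_min p. Proof. by have [] := hp. Qed.
Let rinit0 : 0 < rho_init p. Proof. by have [] := hp. Qed.

Lemma rho_low_gt0 : 0 < rho_low.
Proof. by rewrite lt_min rinit0 rmin0. Qed.

Lemma rho_hat_gt0 : 0 < rho_hat.
Proof. by rewrite lt_max rinit0. Qed.

Lemma rho_max_gt0 : 0 < rho_max p M.
Proof. exact: lt_trans rho_lt. Qed.

Lemma rho_hat_le : rho_hat <= init_excess * rho_max p M.
Proof.
rewrite ge_max; apply/andP; split.
  apply: (@le_trans _ _ (rho_init p / rho_min p * rho_max p M)).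
    by rewrite -mulrA ler_peMr ?(ltW rinit0) // mulrC ler_pdivlMr // mul1r ltW.
  by rewrite ler_wpM2r ?(ltW rho_max_gt0) // /init_excess le_max lexx orbT.
by rewrite ler_peMl ?(ltW rho_max_gt0) // /init_excess le_max lexx.
Qed.

Lemma inv_sqr_rho_le rho : rho_low <= rho ->
  (rho ^+ 2)^-1 <= init_deficit / rho_min p ^+ 2.
Proof.
move=> hr; have r0 := lt_le_trans rho_low_gt0 hr.
rewrite ler_pdivlMr ?exprn_gt0 // mulrC ler_pdivrMr ?exprn_gt0 //.
move: hr; rewrite /rho_low ge_min => /orP[hr|hr].
  apply: (@le_trans _ _ ((rho_min p / rho_init p) ^+ 2 * rho ^+ 2)); last first.
    by rewrite ler_wpM2r ?sqr_ge0 // /init_deficit le_max lexx orbT.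
  rewrite -exprMn ler_sqr ?nnegrE ?mulr_ge0 ?invr_ge0 ?(ltW rmin0) ?(ltW r0) ?(ltW rinit0) //.
  by rewrite -mulrA ler_peMr ?(ltW rmin0) // mulrC ler_pdivlMr // mul1r.
apply: (@le_trans _ _ (1 * rho ^+ 2)).
  by rewrite mul1r ler_sqr ?nnegrE ?(ltW rmin0) ?(ltW r0).
by rewrite ler_wpM2r ?sqr_ge0 // /init_deficit le_max lexx.
Qed.

Lemma grad_factor_ge1 : 1 <= grad_factor.
Proof.
have e1 : 1 <= init_excess by rewrite /init_excess le_max lexx.
have d1 : 1 <= init_deficit by rewrite /init_deficit le_max lexx.
rewrite /grad_factor -[leLHS]mulr1 ler_pM //; last by rewrite -[leLHS]mulr1 ler_pM //; lra.
Qed.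

Section Step.
Context {n : nat} (f : 'rV[R]_n -> R) (x0 : 'rV[R]_n) (eps : R).
Hypothesis f2 : twice_differentiable f.
Hypothesis fM : lipschitz_hessian f M.
Hypothesis fb : has_lbound (range f).
Hypothesis eps0 : 0 < eps.

Let Delta := f x0 - fstar f.
Let gmax x : R := Num.max (l2norm (grad f x)) eps.

Lemma fstar_le x : fstar f <= f x.
Proof. by apply: ge_inf => //; exists x. Qed.

Lemma Delta_ge0 : 0 <= Delta.
Proof. by rewrite subr_ge0 fstar_le. Qed.

(** After a sufficient decrease the gradient may have grown, but not beyond the
    constant [Ga]: the decrease bounds the old gradient by the gap to the
    infimum, and the multiplier term is bounded by the same gap. *)
Lemma grad_after_decrease x rho d sigma radius lam :
  rho_low <= rho <= rho_hat -> f x <= f x0 ->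
  strategy f eps x rho = (sigma, radius) ->
  subproblem_solution f x sigma radius d lam ->
  f (x + d) - f x <= - (Defs.eta p / rho * Num.sqrt (gmax x) ^+ 3) ->
  l2norm (grad f (x + d)) <= xi p * gmax x + lam * l2norm d ->
  l2norm (grad f (x + d)) <= grad_factor * Ga p M f x0 eps.
Proof.
move=> /andP[rlo rhi] fx S sol dec g'.
have r0 := lt_le_trans rho_low_gt0 rlo.
have [/andP[e0 e1] /andP[xi0 xi1] _ _ _] := hp.
have e_1 : 1 <= init_excess by rewrite /init_excess le_max lexx.
have d_1 : 1 <= init_deficit by rewrite /init_deficit le_max lexx.
have rm0 := rho_max_gt0.
have De0 := Delta_ge0.
have drop : f x - f (x + d) <= Delta.
  by apply: lerB => //; exact: fstar_le.
have G0 : 0 < gmax x by rewrite /gmax lt_max eps0 orbT.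
have rhoK : rho <= init_excess * rho_max p M := le_trans rhi rho_hat_le.
set Y := rho_max p M * Delta / Defs.eta p.
have Y0 : 0 <= Y by exact: (divr_ge0 (mulr_ge0 (ltW rm0) De0) (ltW e0)).
have gY : gmax x <= init_excess * Y `^ (2 / 3).
  have -> : gmax x = Num.sqrt (gmax x) ^+ 2 by rewrite sqr_sqrtr // ltW.
  apply: sqr_le_powR23 => //.
  have h : Defs.eta p / rho * Num.sqrt (gmax x) ^+ 3 <= Delta by lra.
  have -> : init_excess * Y = init_excess * rho_max p M * (Delta / Defs.eta p).
    by rewrite /Y; ring.
  apply: (@le_trans _ _ (rho * (Delta / Defs.eta p))).
    rewrite -(ler_pM2l (divr_gt0 e0 r0)); apply: (le_trans h).
    by apply: le_of_eq; field; rewrite !gt_eqF.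
  by rewrite ler_wpM2r // divr_ge0 // ltW.
have mult := multiplier_le _ _ f2 (ltW M0) fM _ eps0 _ _ _ _ _ _ _ r0 De0 S sol drop.
rewrite -/(gmax x) in mult.
set A := (xi p + M / (6 * rho_min p ^+ 2) + 16 * Defs.eta p) * Y `^ (2 / 3).
set B := 32 * rho_max p M * Delta / Num.sqrt eps.
have AG : A <= Ga p M f x0 eps by rewrite /Ga le_max lexx.
have BG : B <= Ga p M f x0 eps by rewrite /Ga !le_max lexx !orbT.
have se0 : 0 < Num.sqrt eps by rewrite sqrtr_gt0.
have b1 : 8 * rho * Delta / Num.sqrt (gmax x) <= init_excess * B.
  apply: (@le_trans _ _ (8 * rho * Delta / Num.sqrt eps)).
    rewrite ler_wpM2l ?mulr_ge0 ?(ltW r0) // lef_pV2 ?posrE ?sqrtr_gt0 //.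
    by rewrite ler_sqrt ?(ltW G0) // /gmax le_max lexx orbT.
  have -> : init_excess * B =
     32 * (init_excess * rho_max p M) * Delta / Num.sqrt eps by rewrite /B; ring.
  rewrite ler_wpM2r ?invr_ge0 ?(ltW se0) // ler_wpM2r //.
  by apply: ler_pM => //; [exact: ltW|lra].
have b2 : (xi p + M / (12 * rho ^+ 2)) * gmax x <= init_excess * init_deficit * A.
  have c1 : xi p + M / (12 * rho ^+ 2) <= init_deficit *
     (xi p + M / (6 * rho_min p ^+ 2) + 16 * Defs.eta p).
    have h := ler_wpM2l (ltW M0) (inv_sqr_rho_le _ rlo).
    have h0 : 0 <= M / rho ^+ 2 by rewrite divr_ge0 ?sqr_ge0 // ltW.
    have hx : xi p <= init_deficit * xi p by rewrite ler_peMl //; lra.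
    have he : 0 <= init_deficit * Defs.eta p by rewrite mulr_ge0 //; lra.
    have -> : M / (12 * rho ^+ 2) = 12^-1 * (M / rho ^+ 2).
      by field; rewrite gt_eqF.
    have -> : init_deficit * (xi p + M / (6 * rho_min p ^+ 2) + 16 * Defs.eta p)
      = init_deficit * xi p + 6^-1 * (M * (init_deficit / rho_min p ^+ 2))
        + 16 * (init_deficit * Defs.eta p) by field; rewrite gt_eqF.
    move: h h0 hx he; move: (init_deficit * xi p) (init_deficit * Defs.eta p) (M * (_ / _)) (M / _).
    by move=> *; lra.
  have -> : init_excess * init_deficit * A =
    (init_deficit * (xi p + M / (6 * rho_min p ^+ 2) + 16 * Defs.eta p)) *
    (init_excess * Y `^ (2 / 3)) by rewrite /A; ring.
  apply: ler_pM => //; last exact: ltW.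
  by rewrite addr_ge0 ?divr_ge0 ?mulr_ge0 ?exprn_ge0 ?(ltW M0) ?(ltW r0) //; lra.
apply: (le_trans g'); apply: (le_trans (lerD (lexx _) mult)).
rewrite addrCA -mulrDl; apply: (le_trans (lerD b1 b2)).
have G_0 : 0 <= Ga p M f x0 eps.
  by rewrite /Ga !le_max l2norm_ge0 orbT.
have ed : 0 <= init_excess * init_deficit.
  by rewrite mulr_ge0 //; lra.
have -> : grad_factor * Ga p M f x0 eps =
   init_excess * init_deficit * Ga p M f x0 eps
   + init_excess * init_deficit * Ga p M f x0 eps by rewrite /grad_factor; ring.
apply: lerD; last by rewrite ler_wpM2l.
apply: (@le_trans _ _ (init_excess * Ga p M f x0 eps)).
  by rewrite ler_wpM2l //; lra.
by rewrite ler_wpM2r // ler_peMr //; lra.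
Qed.

End Step.

End Penalties.

(** * Counting the iterations *)

(** The budget of accepted steps, [A] of them so far, when a decrease step
    resets the potential [P] of the gradient. *)
Lemma budget_reset {R : realType} (A D b C P P' : R) :
  A * b + P <= D * (b + C) + C -> 0 <= P -> P' <= C ->
  (A + 1) * b + P' <= (D + 1) * (b + C) + C.
Proof. lra. Qed.

(** The same budget when a contraction of the gradient pays for the step. *)
Lemma budget_contract {R : realType} (A b B P P' : R) :
  A * b + P <= B -> P' + b <= P -> (A + 1) * b + P' <= B.
Proof. lra. Qed.

Section Count.
Context {R : realType}.
Variables (p : params R) (M : R).
Hypothesis hp : valid_params p.
Hypothesis M0 : 0 < M.
Hypothesis rho_lt : rho_min p < rho_max p M.
Context {n : nat} (f : 'rV[R]_n -> R) (x0 : 'rV[R]_n) (eps : R).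
Hypothesis f2 : twice_differentiable f.
Hypothesis fM : lipschitz_hessian f M.
Hypothesis fb : has_lbound (range f).
Hypothesis eps0 : 0 < eps.
Variables (x : nat -> 'rV[R]_n) (rho : nat -> R) (d : nat -> 'rV[R]_n).
Variable lam : nat -> R.
Hypothesis hrun : run p f eps x0 x rho d lam.

Let b : R := - ln (xi p).

Let g t : R := l2norm (grad f (x t)).

(** Up to the factor [b], a bound of the number of contractions by [xi] that
    the gradient norm can undergo before it is below the tolerance. Truncating
    at [xi * eps], not at [eps], makes the last contraction count too. *)
Definition potential t : R := ln (Num.max (g t) (xi p * eps) / (xi p * eps)).

Definition potential_cap : R :=
  ln (grad_factor p / xi p) + ln (Num.max 1 (Ga p M f x0 eps / eps)).

Definition min_decrease : R := Defs.eta p / rho_hat p M * Num.sqrt eps ^+ 3.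

Let xi0 : 0 < xi p. Proof. have [_ /andP[h _] _ _ _] := hp; lra. Qed.
Let xi1 : xi p < 1. Proof. by have [_ /andP[_ h] _ _ _] := hp. Qed.
Let eta0 : 0 < Defs.eta p. Proof. by have [/andP[h _] _ _ _ _] := hp. Qed.
Let g1 : 1 < gamma1 p. Proof. by have [_ _ _ _ []] := hp. Qed.
Let g2 : 1 < gamma2 p. Proof. by have [_ _ _ _ []] := hp. Qed.
Let g1_gt0 : 0 < gamma1 p. Proof. exact: lt_trans g1. Qed.
Let g2_gt0 : 0 < gamma2 p. Proof. exact: lt_trans g2. Qed.
Let xe0 : 0 < xi p * eps. Proof. exact: mulr_gt0. Qed.
Let rh0 : 0 < rho_hat p M := rho_hat_gt0 p M hp.
Let rl0 : 0 < rho_low p := rho_low_gt0 p hp.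
Let rmin0 : 0 < rho_min p. Proof. by have [] := hp. Qed.
Let rinit0 : 0 < rho_init p. Proof. by have [] := hp. Qed.

Let ratio_gt0 t : 0 < Num.max (g t) (xi p * eps) / (xi p * eps).
Proof. by apply: divr_gt0 => //; rewrite lt_max xe0 orbT. Qed.

Lemma potential_ge0 t : 0 <= potential t.
Proof.
by apply: ln_ge0; rewrite ler_pdivlMr // mul1r le_max lexx orbT.
Qed.

Lemma potential_le_cap t :
  g t <= grad_factor p * Ga p M f x0 eps -> potential t <= potential_cap.
Proof.
move=> gt; set u := Num.max 1 (Ga p M f x0 eps / eps).
have u0 : 0 < u by rewrite lt_max ltr01.
have u1 : 1 <= u by rewrite le_max lexx.
have c1 : 1 <= grad_factor p by exact: grad_factor_ge1.
have c0 : 0 < grad_factor p by apply: lt_le_trans c1.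
have q0 : 0 < grad_factor p / xi p := divr_gt0 c0 xi0.
rewrite /potential_cap -lnM ?posrE // ler_ln ?posrE ?(mulr_gt0 q0 u0) //.
rewrite ler_pdivrMr //.
have -> : grad_factor p / xi p * u * (xi p * eps) = grad_factor p * (u * eps).
  by field; rewrite gt_eqF.
rewrite ge_max; apply/andP; split.
  apply: (le_trans gt); rewrite ler_wpM2l ?(ltW c0) //.
  by rewrite -ler_pdivrMr // le_max lexx orbT.
apply: (@le_trans _ _ (1 * (1 * eps))).
  by rewrite !mul1r ler_piMl ?(ltW eps0) // ltW.
apply: ler_pM => //; first by rewrite mul1r ltW.
by rewrite ler_wpM2r // ltW.
Qed.

Lemma potential_contracts t :
  eps <= g t -> g t.+1 <= xi p * g t -> potential t.+1 + b <= potential t.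
Proof.
move=> ge ct; rewrite /b -lerBrDr opprK.
have gt0 : 0 < g t by apply: lt_le_trans ge.
have m0 := mulr_gt0 (ratio_gt0 t) xi0.
rewrite /potential -lnM ?posrE // ler_ln ?posrE //.
rewrite mulrAC ler_wpM2r ?invr_ge0 ?(ltW xe0) //.
rewrite ge_max; apply/andP; split.
  by apply: (le_trans ct); rewrite mulrC ler_wpM2r ?(ltW xi0) // le_max lexx.
rewrite mulrC ler_wpM2r ?(ltW xi0) //.
by apply: (le_trans ge); rewrite le_max lexx.
Qed.

(** The state after [t] subproblems, of which [A] were accepted and [J]
    rejected; [D] of the accepted ones are decrease steps. *)
Record counts (t A D J : nat) : Prop := Counts {
  total : t = (A + J)%N;
  rho_bounds : rho_low p <= rho t <= rho_hat p M;
  descent : f (x t) + D%:R * min_decrease <= f x0;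
  contraction :
    A%:R * b + potential t <= D%:R * (b + potential_cap) + potential_cap;
  inflation : J%:R * ln (gamma1 p) <=
    ln (rho t) - ln (rho_init p) + A%:R * ln (gamma2 p) }.

Lemma min_decrease_ge0 : 0 <= min_decrease.
Proof. by rewrite mulr_ge0 ?exprn_ge0 ?sqrtr_ge0 // divr_ge0 ?ltW. Qed.

Lemma counts_start : counts 0 0 0 0.
Proof.
have [hx hr _] := hrun.
split=> //; rewrite ?mul0r ?add0r ?addr0 ?hx ?hr //.
- by rewrite /rho_low /rho_hat ge_min le_max !lexx.
- apply: potential_le_cap; rewrite /g hx.
  apply: (@le_trans _ _ (1 * Ga p M f x0 eps)).
    by rewrite mul1r /Ga !le_max lexx orbT.
  rewrite ler_wpM2r ?grad_factor_ge1 //.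
  by rewrite /Ga !le_max l2norm_ge0 orbT.
- by rewrite subrr.
Qed.

(** A rejected penalty was below [rho_max / gamma1], which is what keeps the
    penalty bounded. *)
Lemma counts_step t A D J :
  (forall s, (s <= t)%N -> ~~ terminated f eps (x s) (rho s)) ->
  counts t A D J -> exists A' D' J', counts t.+1 A' D' J'.
Proof.
move=> live [tAJ /andP[rlo rhi] desc contr infl].
have [_ _ /(_ t live)] := hrun.
have r0 : 0 < rho t by apply: lt_le_trans rlo.
have fx : f (x t) <= f x0.
  apply: le_trans desc; rewrite lerDl mulr_ge0 ?min_decrease_ge0 //.
case S: (strategy f eps (x t) (rho t)) => [sigma radius] [sol].
case: ifPn => [acc|rej] [hx hr].
  have [le_f alt ge'] := (acceptedP f p eps eps0 _ _ _ _).1 acc.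
  have rlo' : rho_low p <= rho t.+1.
    by rewrite hr le_max /rho_low ge_min lexx orbT.
  have rhi' : rho t.+1 <= rho_hat p M.
    rewrite hr ge_max; apply/andP; split.
      by rewrite /rho_hat le_max (ltW rho_lt) orbT.
    by apply: le_trans rhi; rewrite ler_pdivrMr // ler_peMr // ltW.
  have infl' : J%:R * ln (gamma1 p) <=
      ln (rho t.+1) - ln (rho_init p) + A.+1%:R * ln (gamma2 p).
    have : ln (rho t) - ln (gamma2 p) <= ln (rho t.+1).
      rewrite -ln_div // ler_ln ?posrE ?divr_gt0 ?(lt_le_trans _ rlo') //.
      by rewrite hr le_max lexx orbT.
    rewrite -natr1 mulrDl mul1r; lra.
  case: alt => [dec|[ge ct]].
    exists A.+1, D.+1, J; split.
    - by rewrite tAJ.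
    - by rewrite rlo' rhi'.
    - have : min_decrease <= f (x t) - f (x t.+1).
        rewrite hx -opprB lerNr; apply: (le_trans dec); rewrite lerN2.
        rewrite /min_decrease; apply: ler_pM.
        + by rewrite divr_ge0 ?ltW.
        + by rewrite exprn_ge0 // sqrtr_ge0.
        + by rewrite ler_wpM2l ?(ltW eta0) // lef_pV2 ?posrE.
        + rewrite lerXn2r ?nnegrE ?sqrtr_ge0 // ler_sqrt.
            by rewrite le_max lexx orbT.
          by rewrite le_max (ltW eps0) orbT.
      rewrite -natr1 mulrDl mul1r; lra.
    - have := potential_le_cap t.+1; rewrite /g hx => /(_ _) cap.
      have {}cap := cap (grad_after_decrease p M hp M0 rho_lt f x0 eps f2 fM fb
        eps0 _ _ _ _ _ _ (introT andP (conj rlo rhi)) fx S sol dec ge').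
      rewrite -!natr1; exact: budget_reset contr (potential_ge0 t) cap.
    - exact: infl'.
  exists A.+1, D, J; split.
  - by rewrite tAJ.
  - by rewrite rlo' rhi'.
  - by apply: le_trans desc; rewrite lerD2r hx.
  - have := potential_contracts t ge; rewrite {1}/g hx => /(_ ct).
    by rewrite -natr1; exact: budget_contract contr.
  - exact: infl'.
have small : gamma1 p * rho t < rho_max p M.
  rewrite ltNge; apply: contra rej => big.
  have [h1 h2 h3 h4] := large_of_rho_max p M hp M0 _ r0 big.
  by apply: (accepted_of_large _ _ f2 (ltW M0) fM) S sol => //; exact: live.
exists A, D, J.+1; split.
- by rewrite addnS tAJ.
- rewrite hr; apply/andP; split.
    by apply: (le_trans rlo); rewrite ler_peMl ?(ltW r0) ?(ltW g1).
  by rewrite /rho_hat le_max (ltW small) orbT.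
- by rewrite hx.
- by rewrite /potential /g hx.
- by rewrite hr lnM // -natr1 mulrDl mul1r; lra.
Qed.

Lemma counts_exist t :
  (forall s, (s < t)%N -> ~~ terminated f eps (x s) (rho s)) ->
  exists A D J, counts t A D J.
Proof.
elim: t => [|t IH] live; first by exists 0%N, 0%N, 0%N; exact: counts_start.
have [|A [D [J c]]] := IH; first by move=> s st; apply: live; exact: ltnW.
by apply: (counts_step t A D J) => // s st; exact: live.
Qed.

Let b0 : 0 < b. Proof. by rewrite /b oppr_gt0 ln_lt0 // xi0. Qed.
Let lg1 : 0 < ln (gamma1 p). Proof. exact: ln_gt0. Qed.
Let lg2 : 0 < ln (gamma2 p). Proof. exact: ln_gt0. Qed.

Let decreases : R :=
  Num.max 1 (rho_max p M * (f x0 - fstar f) * eps `^ (- (3 / 2))).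
Let logs : R := Num.max 1 (ln (Ga p M f x0 eps / eps)).
Let inner_logs : R := Num.max 1 (ln (rho_max p M / rho_min p) / ln (gamma1 p)).

Let decreases_ge1 : 1 <= decreases. Proof. by rewrite le_max lexx. Qed.
Let logs_ge1 : 1 <= logs. Proof. by rewrite le_max lexx. Qed.
Let inner_logs_ge1 : 1 <= inner_logs. Proof. by rewrite le_max lexx. Qed.

(** Each decrease step lowers [f] by a fixed amount, and [f] cannot sink below
    its infimum. *)
Lemma decrease_steps_le t A D J : counts t A D J ->
  D%:R <= init_excess p / Defs.eta p * decreases.
Proof.
move=> [_ _ desc _ _].
have s0 : 0 < Num.sqrt eps ^+ 3 by rewrite exprn_gt0 // sqrtr_gt0.
have e1 : 1 <= init_excess p by rewrite /init_excess le_max lexx.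
have De0 := Delta_ge0 f x0 fb.
have w0 : 0 < min_decrease by rewrite mulr_gt0 // divr_gt0.
have h : D%:R * min_decrease <= f x0 - fstar f.
  have := fstar_le f fb (x t); move: desc; move: (f (x t)) (f x0) (fstar f) => *; lra.
rewrite -ler_pdivlMr // in h; apply: (le_trans h).
have -> : (f x0 - fstar f) / min_decrease =
    rho_hat p M * ((f x0 - fstar f) / Defs.eta p / Num.sqrt eps ^+ 3).
  by rewrite /min_decrease; field; rewrite !gt_eqF // sqrtr_gt0.
apply: (@le_trans _ _ (init_excess p * rho_max p M *
    ((f x0 - fstar f) / Defs.eta p / Num.sqrt eps ^+ 3))).
  rewrite ler_wpM2r ?rho_hat_le // divr_ge0 ?(ltW s0) //.
  exact: divr_ge0 De0 (ltW eta0).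
have -> : init_excess p * rho_max p M *
    ((f x0 - fstar f) / Defs.eta p / Num.sqrt eps ^+ 3) =
  init_excess p / Defs.eta p *
    (rho_max p M * (f x0 - fstar f) * (Num.sqrt eps ^+ 3)^-1) by ring.
rewrite ler_wpM2l ?divr_ge0 ?(ltW eta0) ?(le_trans ler01) //.
by rewrite /decreases powRN powR32 ?(ltW eps0) // le_max lexx orbT.
Qed.

Lemma potential_cap_le :
  potential_cap <= (ln (grad_factor p / xi p) + 1) * logs.
Proof.
have c1 : 1 <= grad_factor p by exact: grad_factor_ge1.
have q1 : 1 <= grad_factor p / xi p.
  by rewrite ler_pdivlMr // mul1r (le_trans (ltW xi1)).
rewrite mulrDl mul1r /potential_cap; apply: lerD.
  by rewrite ler_peMr // ln_ge0.
case: (leP 1 (Ga p M f x0 eps / eps)) => u1.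
  by rewrite /logs le_max lexx orbT.
by rewrite ln1 (le_trans ler01).
Qed.

Definition accept_factor : R :=
  (init_excess p / Defs.eta p * (b + (ln (grad_factor p / xi p) + 1))
   + (ln (grad_factor p / xi p) + 1)) / b.

Definition iteration_factor : R :=
  accept_factor * (1 + ln (gamma2 p) / ln (gamma1 p))
  + (`|ln (init_excess p) + ln (rho_min p) - ln (rho_init p)| / ln (gamma1 p)
     + 1).

Lemma accepted_steps_le t A D J : counts t A D J ->
  A%:R <= accept_factor * (decreases * logs).
Proof.
move=> c; have := decrease_steps_le _ _ _ _ c; have := potential_cap_le.
have [_ _ _ contr _] := c; have := potential_ge0 t.
have q0 : 0 <= ln (grad_factor p / xi p).
  apply: ln_ge0; rewrite ler_pdivlMr // mul1r (le_trans (ltW xi1)) //.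
  exact: grad_factor_ge1.
rewrite /accept_factor [_ / b * _]mulrAC ler_pdivlMr //.
have K0 : 0 <= init_excess p / Defs.eta p.
  by rewrite divr_ge0 ?(ltW eta0) // (le_trans ler01) // /init_excess le_max lexx.
have P0 : 0 <= ln (grad_factor p / xi p) + 1 by rewrite addr_ge0.
move: (ln (grad_factor p / xi p) + 1) P0 (init_excess p / _) K0 contr => P P0 K K0.
move: (A%:R : R) (potential t) => a P' contr P'0 capP DK.
have D0 : 0 <= D%:R :> R by [].
move: (D%:R : R) D0 contr DK => D' D0 contr DK.
have EL : decreases <= decreases * logs by rewrite ler_peMr // (le_trans ler01).
have LE : logs <= decreases * logs by rewrite ler_peMl // (le_trans ler01).
have h1 : D' * (b + potential_cap) <= K * decreases * (b + P * logs).
  apply: (@le_trans _ _ (D' * (b + P * logs))).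
    by rewrite ler_wpM2l // lerD2l.
  rewrite ler_wpM2r // addr_ge0 ?(ltW b0) // mulr_ge0 //.
  by rewrite (le_trans ler01).
have h2 : K * decreases * (b + P * logs) <= K * (b + P) * (decreases * logs).
  have -> : K * decreases * (b + P * logs) =
    K * b * decreases + K * P * (decreases * logs) by ring.
  rewrite mulrDr [leRHS]mulrDl lerD2r ler_wpM2l // mulr_ge0 // ltW //.
have h3 : P * logs <= P * (decreases * logs) by rewrite ler_wpM2l.
rewrite mulrDl; apply: le_trans (lerD h2 h3); apply: le_trans (lerD h1 capP).
by apply: le_trans contr; rewrite lerDl.
Qed.

(** Rejections multiply the penalty by [gamma1] and acceptances divide it by at
    most [gamma2]; as the penalty stays bounded, the rejections are at most a
    fixed multiple of the acceptances, plus the logarithm to base [gamma1] of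
    the range of the penalty. *)
Lemma iterations_le t A D J : counts t A D J ->
  t%:R <= iteration_factor * iteration_bound p M f x0 eps.
Proof.
move=> c; have acc := accepted_steps_le _ _ _ _ c.
have [tAJ /andP[rlo rhi] _ _ infl] := c.
rewrite /iteration_bound -/decreases -/logs -/inner_logs.
have ie0 : 0 < init_excess p by rewrite /init_excess lt_max ltr01.
have rm0 := rho_max_gt0 p M hp rho_lt.
have lnr : ln (rho t) <= ln (init_excess p) + ln (rho_min p)
                          + inner_logs * ln (gamma1 p).
  have : ln (rho t) <= ln (init_excess p) + ln (rho_max p M).
    have ier := mulr_gt0 ie0 rm0.
    rewrite -lnM ?posrE // ler_ln ?posrE ?(lt_le_trans rl0 rlo) //.
    exact: (le_trans rhi (rho_hat_le p M hp rho_lt)).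
  move=> /le_trans; apply; rewrite -addrA lerD2l -lerBlDl -ln_div ?posrE //.
  by rewrite -ler_pdivrMr // /inner_logs le_max lexx orbT.
have J' : J%:R <= `|ln (init_excess p) + ln (rho_min p) - ln (rho_init p)|
                   / ln (gamma1 p) + inner_logs
                   + A%:R * (ln (gamma2 p) / ln (gamma1 p)).
  rewrite -(ler_pM2r lg1); apply: (le_trans infl).
  have -> : forall u v w : R, (u / ln (gamma1 p) + v + w * (ln (gamma2 p) /
     ln (gamma1 p))) * ln (gamma1 p) = u + v * ln (gamma1 p) + w * ln (gamma2 p).
    by move=> u v w; field; rewrite gt_eqF.
  rewrite lerD2r lerBlDr.
  have := ler_norm (ln (init_excess p) + ln (rho_min p) - ln (rho_init p)).
  move: lnr; move: (`|_|) (inner_logs * _) => *; lra.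
rewrite tAJ natrD /iteration_factor mulrDl.
set r := ln (gamma2 p) / ln (gamma1 p) in J' *.
have r0 : 0 <= r by rewrite divr_ge0 // ltW.
have U0 : 0 <= `|ln (init_excess p) + ln (rho_min p) - ln (rho_init p)|
                   / ln (gamma1 p) by rewrite divr_ge0 // ltW.
move: (`|_| / _) U0 J' => u u0 J'.
have A0 : 0 <= A%:R :> R by [].
move: (A%:R : R) (J%:R : R) A0 J' acc => a j a0 J' acc.
have EL1 : 1 <= decreases * logs by rewrite -[leLHS]mulr1 ler_pM.
have ELN1 : inner_logs <= decreases * logs * inner_logs.
  by rewrite ler_peMl // (le_trans ler01).
have h1 : a * (1 + r) <= accept_factor * (1 + r) * (decreases * logs * inner_logs).
  apply: (@le_trans _ _ (accept_factor * (decreases * logs) * (1 + r))).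
    by rewrite ler_wpM2r // addr_ge0.
  have -> : accept_factor * (1 + r) * (decreases * logs * inner_logs) =
    accept_factor * (decreases * logs) * (1 + r) * inner_logs by ring.
  rewrite ler_peMr // mulr_ge0 ?addr_ge0 //.
  exact: le_trans acc.
have h2 : u + inner_logs <= (u + 1) * (decreases * logs * inner_logs).
  apply: (@le_trans _ _ ((u + 1) * inner_logs)).
    rewrite mulrDl mul1r lerD2r ler_peMr //.
  by rewrite ler_wpM2l // addr_ge0.
apply: le_trans (lerD h1 h2); rewrite mulrDr mulr1.
by rewrite -addrA lerD2l [leRHS]addrC.
Qed.

End Count.

(* The O-constants C and Cg depend only on the parameters of the method, and
   the Omega-constant cH only on these and on the Lipschitz constant M. *)
Theorem theorem4p1 (R : realType) (p : params R) (hp : valid_params p) :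
  exists C Cg : R, [/\ 0 < C, 0 < Cg &
    forall M : R, 0 < M -> rho_min p < rho_max p M ->
    exists2 cH : R, 0 < cH &
      forall (n : nat) (f : 'rV[R]_n -> R) (x0 : 'rV[R]_n) (eps : R),
        nonconvex f ->
        twice_differentiable f ->
        has_lbound (range f) ->
        lipschitz_hessian f M ->
        0 < eps ->
        forall (x : nat -> 'rV[R]_n) (rho : nat -> R)
               (d : nat -> 'rV[R]_n) (lam : nat -> R),
          run p f eps x0 x rho d lam ->
          exists N : nat,
            [/\ terminates_after f eps x rho N,
                N%:R <= C * iteration_bound p M f x0 eps,
                l2norm (grad f (x N)) <= Cg * eps
              & - (cH * Num.sqrt eps) <= lambda_min (hess f (x N))]].
Proof.
exists (Num.max 1 (iteration_factor p)), 1; split => //.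
  by rewrite lt_max ltr01.
move=> M M0 rho_lt; exists (rho_hat p M); first exact: rho_hat_gt0.
move=> n f x0 eps _ f2 fb fM eps0 x rho d lam hrun.
have ib0 : 0 <= iteration_bound p M f x0 eps.
  by rewrite /iteration_bound !mulr_ge0 // le_max ler01.
have count t := counts_exist p M hp M0 rho_lt f x0 eps f2 fM fb eps0 x rho d lam
  hrun t.
have bound t : (forall s, (s < t)%N -> ~~ terminated f eps (x s) (rho s)) ->
    t%:R <= Num.max 1 (iteration_factor p) * iteration_bound p M f x0 eps.
  move=> /count[A [D [J c]]].
  apply: le_trans (iterations_le p M hp rho_lt f x0 eps fb eps0 _ _ _ _ _ _ c) _.
  by rewrite ler_wpM2r // le_max lexx orbT.
have [t0 tt0] : exists t, terminated f eps (x t) (rho t).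
  apply: contrapT => none.
  have := bound (Num.truncn (Num.max 1 (iteration_factor p) *
    iteration_bound p M f x0 eps)).+1.
  rewrite leNgt real_truncnS_gt ?num_real // => /(_ _)/negP; apply => //.
  by move=> s _; apply/negP => ts; apply: none; exists s.
have [N tN minN] := ex_minnP (ex_intro (fun t => terminated f eps (x t) (rho t)) t0 tt0).
have live s : (s < N)%N -> ~~ terminated f eps (x s) (rho s).
  by move=> sN; apply/negP => /minN; rewrite leqNgt sN.
exists N; split => //.
- exact: bound.
- by move/andP: tN => [/ltW + _]; rewrite mul1r.
- move/andP: tN => [_ /ltW h]; apply: le_trans h; rewrite lerN2.
  have [A [D [J c]]] := count N live.
  by rewrite ler_wpM2r ?sqrtr_ge0 //; have [_ /andP[]] := c.
Qed.
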